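(* Let $K$ be an algebraically closed field with $\operatorname{char} K = 2$. Let $\mathcal{Q}$ be the quiver with vertices $1,2,3,4$ and arrows $\alpha\colon 1\to 4$, $\beta\colon 4\to 1$, $\xi\colon 2\to 4$, $\epsilon\colon 4\to 2$, $\gamma\colon 3\to 4$, $\delta\colon 4\to 3$, and let $\mathcal{A}_1$ be the quotient of the path algebra $K\mathcal{Q}$ by the two-sided ideal given by the relations $$\beta\alpha+\delta\gamma+\epsilon\xi=0,\quad \gamma\delta=0,\quad \xi\epsilon=0,\quad \alpha\beta=0.$$ Then $\dim_K \mathrm{HH}^2(\mathcal{A}_1)=3$.
   Context: Paths in a quiver are written from left to right: for arrows $a\colon i\to j$ and $b\colon j\to k$, the product $ab$ is the path from $i$ to $k$ that first follows $a$ and then $b$. For a finite dimensional $K$-algebra $\Lambda$, $\mathrm{HH}^2(\Lambda)$ denotes the second Hochschild cohomology group of $\Lambda$ over $K$ with coefficients in $\Lambda$, that is, $\operatorname{Ext}^2$ from $\Lambda$ to $\Lambda$ in the category of $\Lambda,\Lambda$-bimodules (on which $K$ acts centrally). The algebra $\mathcal{A}_1$ is the preprojective algebra of type $D_4$, called the standard algebra. *)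

(* Defs.v *)
From HB Require Import structures.
From mathcomp Require Import all_boot all_order all_algebra.
From mathcomp Require Import finmap boolp.
From mathcomp Require Import monalg.

Set Implicit Arguments.
Unset Strict Implicit.
Unset Printing Implicit Defensive.

Import GRing.Theory.
Local Open Scope ring_scope.

(* The vertex set is nonempty because MathComp algebras satisfy [1 != 0]. *)
Record quiver := Quiver {
  vertex : finType;
  arrow : finType;
  source : arrow -> vertex;
  target : arrow -> vertex;
  vertex_gt0 : (0 < #|vertex|)%N
}.

Section Paths.
Variable Q : quiver.

Fixpoint walk (v : vertex Q) (s : seq (arrow Q)) : bool :=
  if s is a :: s' then (source a == v) && walk (target a) s' else true.

Fixpoint walk_end (v : vertex Q) (s : seq (arrow Q)) : vertex Q :=
  if s is a :: s' then walk_end (target a) s' else v.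

(* A path is its starting vertex together with the list of its arrows, in the
   order in which they are followed; [(v, [::])] is the trivial path at [v]. *)
Definition qpath := {vs : vertex Q * seq (arrow Q) | walk vs.1 vs.2}.

Definition path_source (p : qpath) : vertex Q := (val p).1.
Definition path_arrows (p : qpath) : seq (arrow Q) := (val p).2.
Definition path_target (p : qpath) : vertex Q :=
  walk_end (path_source p) (path_arrows p).

Lemma walk_cat v s t : walk v (s ++ t) = walk v s && walk (walk_end v s) t.
Proof. by elim: s v => //= a s IHs v; rewrite IHs andbA. Qed.

Lemma walk_end_cat v s t : walk_end v (s ++ t) = walk_end (walk_end v s) t.
Proof. by elim: s v => //= a s IHs v; rewrite IHs. Qed.

Definition trivial_path (v : vertex Q) : qpath :=
  exist (fun vs => walk vs.1 vs.2) (v, [::]) isT.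

(* [p] first, then [q]; [None] if [q] does not start where [p] ends. *)
Definition path_comp (p q : qpath) : option qpath :=
  if path_source q == path_target p
  then (insub (path_source p, path_arrows p ++ path_arrows q) : option qpath)
  else None.

Lemma path_comp_val p q : path_source q = path_target p ->
  exists2 r, path_comp p q = Some r &
    val r = (path_source p, path_arrows p ++ path_arrows q).
Proof.
move=> e; rewrite /path_comp e eqxx.
have h : walk (path_source p) (path_arrows p ++ path_arrows q).
  rewrite walk_cat (valP p) /=.
  have -> : walk_end (path_source p) (path_arrows p) = path_source q by [].
  exact: (valP q).
by case: insubP => [r _ hr|/negP[]//]; exists r.
Qed.

Lemma path_comp_None p q :
  path_source q != path_target p -> path_comp p q = None.
Proof. by rewrite /path_comp => /negbTE->. Qed.

Lemma path_comp_target p q r : path_comp p q = Some r ->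
  path_source r = path_source p /\ path_target r = path_target q.
Proof.
case: (eqVneq (path_source q) (path_target p)) => [e|/path_comp_None->//].
have [r' -> hr] := path_comp_val e => -[<-].
split; first by rewrite /path_source hr.
rewrite /path_target {1}/path_source /path_arrows hr /= walk_end_cat.
by rewrite -/(path_target p) -e.
Qed.

Lemma path_compA p q r :
  obind (path_comp p) (path_comp q r) = obind (path_comp^~ r) (path_comp p q).
Proof.
case: (eqVneq (path_source r) (path_target q)) => [e|ne].
- have [qr Eqr vqr] := path_comp_val e; have [s_qr t_qr] := path_comp_target Eqr.
  rewrite Eqr /=.
  case: (eqVneq (path_source q) (path_target p)) => [f|nf]; last first.
    by rewrite !path_comp_None // s_qr.
  have [pq Epq vpq] := path_comp_val f; have [s_pq t_pq] := path_comp_target Epq.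
  rewrite Epq /=.
  have [x -> vx] : exists2 x, path_comp p qr = Some x & val x =
      (path_source p, path_arrows p ++ path_arrows qr).
    by apply: path_comp_val; rewrite s_qr.
  have [y -> vy] : exists2 y, path_comp pq r = Some y & val y =
      (path_source pq, path_arrows pq ++ path_arrows r).
    by apply: path_comp_val; rewrite t_pq.
  congr Some; apply: val_inj; rewrite vx vy s_pq /path_arrows vqr vpq /=.
  by rewrite catA.
- rewrite [path_comp q r]path_comp_None //=.
  case Epq: path_comp => [pq|] //=; rewrite path_comp_None //.
  by have [_ ->] := path_comp_target Epq.
Qed.

Lemma path_comp1p v p :
  path_comp (trivial_path v) p = if v == path_source p then Some p else None.
Proof.
case: eqP => [->|/eqP ne]; last by rewrite path_comp_None // eq_sym.
have [r -> vr] := @path_comp_val (trivial_path (path_source p)) p erefl.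
by congr Some; apply: val_inj; rewrite vr /path_source /path_arrows /=;
   case: (val p).
Qed.

Lemma path_compp1 v p :
  path_comp p (trivial_path v) = if v == path_target p then Some p else None.
Proof.
case: eqP => [->|/eqP ne]; last by rewrite path_comp_None.
have [r -> vr] := @path_comp_val p (trivial_path (path_target p)) erefl.
by congr Some; apply: val_inj; rewrite vr cats0 /path_source /path_arrows;
   case: (val p).
Qed.

End Paths.

Section LinearExtension.
Variables (K : fieldType) (B : choiceType) (V : lmodType K) (F : B -> V).

Definition lin_ext (g : {malg K[B]}) : V := \sum_(b <- msupp g) g@_b *: F b.

Lemma lin_extw (d : {fset B}) g : (msupp g `<=` d)%fset ->
  lin_ext g = \sum_(b <- d) g@_b *: F b.
Proof.
by move=> le_d; apply: big_fset_incl => // b _ /mcoeff_outdom ->; rewrite scale0r.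
Qed.

Lemma lin_ext_is_linear : linear lin_ext.
Proof.
move=> c g h.
have le1 : (msupp (c *: g + h) `<=` msupp g `|` msupp h)%fset.
  by apply: fsubset_trans (msuppD_le _ _) _; rewrite fsetSU // msuppZ_le.
rewrite (lin_extw le1) (lin_extw (fsubsetUl (msupp g) (msupp h))).
rewrite (lin_extw (fsubsetUr (msupp g) (msupp h))) scaler_sumr -big_split /=.
by apply: eq_bigr => b _; rewrite mcoeffD mcoeffZ scalerDl scalerA.
Qed.

HB.instance Definition _ :=
  GRing.isLinear.Build K {malg K[B]} V *:%R lin_ext lin_ext_is_linear.

Lemma lin_extU b : lin_ext << b >> = F b.
Proof.
by rewrite (lin_extw (@msuppU_le _ _ b 1)) big_seq_fset1 mcoeffUU scale1r.
Qed.

Lemma lin_ext_eq (f : {linear {malg K[B]} -> V}) :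
  (forall b, f << b >> = F b) -> f =1 lin_ext.
Proof.
move=> fF g; rewrite {1}[g]monalgE raddf_sum; apply: eq_bigr => b _.
rewrite -fF -linearZ /=; congr (f _); apply/malgP => b'.
by rewrite mcoeffZ !mcoeffU mulr_natr.
Qed.

End LinearExtension.

Lemma malg_linear_ext (K : fieldType) (B : choiceType) (V : lmodType K)
    (f g : {linear {malg K[B]} -> V}) :
  (forall b, f << b >> = g << b >>) -> f =1 g.
Proof.
by move=> fg x; rewrite (lin_ext_eq fg) -(@lin_ext_eq _ _ _ _ g).
Qed.

Definition path_algebra (K : fieldType) (Q : quiver) := {malg K[qpath Q]}.

HB.instance Definition _ (K : fieldType) (Q : quiver) :=
  GRing.Lmodule.on (path_algebra K Q).

(* [path_elt] and [path_mul] are locked to keep unification from unfolding the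
   finitely supported functions underneath. *)
HB.lock Definition path_elt (K : fieldType) (Q : quiver) (p : qpath Q) :
  path_algebra K Q := << p >>.

Definition opath_elt (K : fieldType) (Q : quiver) (r : option (qpath Q)) :
  path_algebra K Q := if r is Some p then path_elt K p else 0.

HB.lock Definition path_mul (K : fieldType) (Q : quiver)
    (x y : path_algebra K Q) : path_algebra K Q :=
  lin_ext (fun p => lin_ext (fun q => opath_elt K (path_comp p q)) y) x.

Definition path_one (K : fieldType) (Q : quiver) : path_algebra K Q :=
  \sum_(v : vertex Q) path_elt K (trivial_path v).

Section PathAlgebra.
Variables (K : fieldType) (Q : quiver).
Local Notation path_algebra := (path_algebra K Q).
Local Notation path_mul := (@path_mul K Q).
Local Notation path_one := (path_one K Q).
Implicit Types (p q : qpath Q) (x y z : path_algebra).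

Lemma path_linear_ext (V : lmodType K) (f g : {linear path_algebra -> V}) :
  (forall p, f (path_elt K p) = g (path_elt K p)) -> f =1 g.
Proof. by rewrite unlock; exact: malg_linear_ext. Qed.

Lemma path_mul_linear_r x : linear (path_mul x).
Proof.
move=> c y y'.
have E z : path_mul x z = \sum_(p <- msupp x)
    x@_p *: lin_ext (fun q => opath_elt K (path_comp p q)) z by rewrite unlock.
rewrite !E scaler_sumr -big_split /=; apply: eq_bigr => p _; rewrite linearP /=.
by rewrite scalerDr !scalerA mulrC.
Qed.

HB.instance Definition _ x := GRing.isLinear.Build K path_algebra path_algebra
  *:%R (path_mul x) (path_mul_linear_r x).

Definition path_mulr y x := path_mul x y.

Lemma path_mul_linear_l y : linear (path_mulr y).
Proof. by move=> c x x'; rewrite /path_mulr unlock linearP. Qed.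

HB.instance Definition _ y := GRing.isLinear.Build K path_algebra path_algebra
  *:%R (path_mulr y) (path_mul_linear_l y).

Lemma path_mulE p q :
  path_mul (path_elt K p) (path_elt K q) = opath_elt K (path_comp p q).
Proof. by rewrite unlock [path_elt]unlock !lin_extU. Qed.

Lemma path_mulA : associative path_mul.
Proof.
move=> x y z.
have H1 : path_mulr (path_mul y z) =1 path_mulr z \o path_mulr y.
  apply: path_linear_ext => p /=.
  have H2 : path_mul (path_elt K p) \o path_mulr z =1 path_mulr z \o path_mul (path_elt K p).
    apply: path_linear_ext => q /=.
    have H3 : path_mul (path_elt K p) \o path_mul (path_elt K q) =1
              path_mul (path_mul (path_elt K p) (path_elt K q)).
      apply: (path_linear_ext (f := path_mul (path_elt K p) \o path_mul (path_elt K q))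
        (g := path_mul (path_mul (path_elt K p) (path_elt K q)))) => r.
      rewrite /=.
      rewrite !path_mulE.
      have := path_compA p q r.
      case: (path_comp q r) => [qr|]; case: (path_comp p q) => [pq|] /=;
        rewrite ?path_mulE.
      - by move->.
      - by move->; rewrite -/(path_mulr _ _) linear0.
      - by move<-; rewrite linear0.
      - by move=> _; rewrite linear0 -/(path_mulr _ _) linear0.
    exact: (H3 z).
  exact: (H2 y).
exact: (H1 x).
Qed.

Lemma path_mul1r : left_id path_one path_mul.
Proof.
move=> x; have H : path_mul path_one =1 idfun.
  apply: path_linear_ext => p /=.
  rewrite -/(path_mulr _ _) raddf_sum (bigD1 (path_source p)) //= big1 => [|v nv].
    by rewrite addr0 /path_mulr path_mulE path_comp1p eqxx.
  by rewrite /path_mulr path_mulE path_comp1p (negbTE nv).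
exact: H.
Qed.

Lemma path_mulr1 : right_id path_one path_mul.
Proof.
move=> x; have H : path_mulr path_one =1 idfun.
  apply: path_linear_ext => p /=.
  rewrite /path_mulr raddf_sum (bigD1 (path_target p)) //= big1 => [|v nv].
    by rewrite addr0 path_mulE path_compp1 eqxx.
  by rewrite path_mulE path_compp1 (negbTE nv).
exact: H.
Qed.

Lemma path_mulDl : left_distributive path_mul +%R.
Proof. by move=> x y z; exact: (linearD (path_mulr z)). Qed.

Lemma path_mulDr : right_distributive path_mul +%R.
Proof. by move=> x y z; rewrite linearD. Qed.

Lemma path_one_neq0 : path_one != 0.
Proof.
have /card_gt0P[v _] := vertex_gt0 Q.
apply/eqP/malgP => /(_ (trivial_path v)) /eqP.
rewrite raddf_sum (bigD1 v) //= big1 => [|w nw].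
  by rewrite unlock addr0 mcoeffUU mcoeff0 oner_eq0.
rewrite unlock mcoeffU; case: eqP => // /(congr1 (@path_source Q)) /eqP.
by rewrite /path_source /= (negbTE nw).
Qed.

HB.instance Definition _ := GRing.Zmodule_isNzRing.Build path_algebra
  path_mulA path_mul1r path_mulr1 path_mulDl path_mulDr path_one_neq0.

Lemma path_scaleAl (c : K) x y : c *: (x * y) = (c *: x) * y.
Proof. exact: esym (linearZ_LR (path_mulr y) c x). Qed.

Lemma path_scaleAr (c : K) x y : c *: (x * y) = x * (c *: y).
Proof. exact: esym (linearZ_LR (path_mul x) c y). Qed.

HB.instance Definition _ :=
  GRing.Lmodule_isLalgebra.Build K path_algebra path_scaleAl.
HB.instance Definition _ :=
  GRing.Lalgebra_isAlgebra.Build K path_algebra path_scaleAr.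

End PathAlgebra.

Definition trivial_coef (K : fieldType) (Q : quiver) (v : vertex Q)
  (x : path_algebra K Q) : K^o := x@_(trivial_path v).

Section TrivialCoef.
Variables (K : fieldType) (Q : quiver) (v : vertex Q).
Local Notation path_algebra := (path_algebra K Q).
Local Notation eps := (@trivial_coef K Q v).

Lemma trivial_coef_is_linear : linear eps.
Proof. by move=> c x y; rewrite /eps mcoeffD mcoeffZ. Qed.

HB.instance Definition _ :=
  GRing.isLinear.Build K path_algebra K^o *:%R eps trivial_coef_is_linear.

Lemma trivial_coef_path p : eps (path_elt K p) = (p == trivial_path v)%:R.
Proof. by rewrite /eps unlock mcoeffU. Qed.

Lemma trivial_coefM x y : eps (x * y) = eps x * eps y.
Proof.
have H2 p : eps \o path_mul (path_elt K p) =1 eps (path_elt K p) \*: eps.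
  apply: path_linear_ext => q.
  rewrite /= path_mulE !trivial_coef_path.
  case: (eqVneq p (trivial_path v)) => [->|np].
    rewrite path_comp1p scale1r.
    case: (eqVneq v (path_source q)) => [_|nv] /=.
      by rewrite trivial_coef_path.
    rewrite linear0; case: eqP => // eq_q.
    by rewrite eq_q /path_source eqxx in nv.
  rewrite scale0r.
  case Epq: path_comp => [r|] /=; last by rewrite linear0.
  rewrite trivial_coef_path; case: eqP => // er.
  case: (eqVneq (path_source q) (path_target p)) => [e|/path_comp_None];
    last by rewrite Epq.
  have [r' Er' vr'] := path_comp_val e.
  move: Er'; rewrite Epq => -[e']; move: vr'; rewrite -e' er /= => -[ev].
  case: p np e Epq => -[w s] /= ws np e Epq in ev *.
  rewrite /path_source /path_arrows /= in ev *.
  case: s ws np e Epq => //= ws np e Epq _.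
  case/eqP: np; apply: val_inj => /=.
  by rewrite ev.
have H1 : eps \o path_mulr y =1 eps y \*: eps.
  apply: path_linear_ext => p /=; rewrite [LHS]H2 /=.
  exact: mulrC.
by rewrite [LHS]H1 /= [LHS]mulrC.
Qed.

Lemma trivial_coef1 : eps 1 = 1.
Proof.
rewrite raddf_sum (bigD1 v) //= big1 => [|w nw].
  by rewrite addr0 trivial_coef_path eqxx.
rewrite trivial_coef_path; case: eqP => // /(congr1 (@path_source Q)) /eqP.
by rewrite /path_source /= (negbTE nw).
Qed.

End TrivialCoef.

(* Two-sided. Closure under scaling by [K] follows from [c *: x = (c *: 1) * x],
   closure under opposites from [- x = -1 * x]. *)
Record proper_ideal (K : fieldType) (A : algType K) := ProperIdeal {
  in_ideal :> A -> Prop;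
  in_ideal0 : in_ideal 0;
  in_idealD : forall x y, in_ideal x -> in_ideal y -> in_ideal (x + y);
  in_idealMl : forall a x, in_ideal x -> in_ideal (a * x);
  in_idealMr : forall a x, in_ideal x -> in_ideal (x * a);
  in_ideal1 : ~ in_ideal 1
}.

Definition ideal_pred (K : fieldType) (A : algType K) (I : proper_ideal A) :
  pred A := fun x => `[< I x >].

Section IdealPred.
Variables (K : fieldType) (A : algType K) (I : proper_ideal A).

Lemma ideal_predP x : reflect (I x) (x \in ideal_pred I).
Proof. exact: asboolP. Qed.

Lemma ideal_pred_zmod_closed : zmod_closed (ideal_pred I).
Proof.
split=> [|x y /ideal_predP Ix /ideal_predP Iy]; apply/ideal_predP.
  exact: in_ideal0.
by apply: in_idealD => //; rewrite -mulN1r; apply: in_idealMl.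
Qed.

HB.instance Definition _ :=
  GRing.isZmodClosed.Build A (ideal_pred I) ideal_pred_zmod_closed.

Lemma ideal_predMl a x : x \in ideal_pred I -> a * x \in ideal_pred I.
Proof. by move=> /ideal_predP Ix; apply/ideal_predP/in_idealMl. Qed.

Lemma ideal_predMr a x : x \in ideal_pred I -> x * a \in ideal_pred I.
Proof. by move=> /ideal_predP Ix; apply/ideal_predP/in_idealMr. Qed.

Lemma ideal_predZ (c : K) x : x \in ideal_pred I -> c *: x \in ideal_pred I.
Proof. by rewrite -[x in c *: x]mul1r scalerAl; apply: ideal_predMl. Qed.

End IdealPred.

Definition quot_algebra (K : fieldType) (A : algType K) (I : proper_ideal A) :=
  Quotient.quot (GRing.ZmodClosed.clone A (ideal_pred I) _).

Section QuotAlgebra.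
Variables (K : fieldType) (A : algType K) (I : proper_ideal A).
Local Notation Q := (quot_algebra I).

HB.instance Definition _ := GRing.Zmodule.on Q.
HB.instance Definition _ := EqQuotient.on Q.

Definition quot_proj (x : A) : Q := \pi_Q%qT x.

Lemma quot_projE x y : quot_proj x = quot_proj y <-> I (x - y).
Proof.
split=> [/eqP|Ixy]; last (apply/eqP; move/ideal_predP: Ixy);
  by rewrite -Quotient.idealrBE // => /ideal_predP.
Qed.

Lemma quot_projD x y : quot_proj (x + y) = quot_proj x + quot_proj y.
Proof. exact: raddfD. Qed.

Lemma quot_projK (x : Q) : quot_proj (repr x) = x.
Proof. exact: reprK. Qed.

Definition quot_one : Q := quot_proj 1.
Definition quot_mul (x y : Q) : Q := quot_proj (repr x * repr y).
Definition quot_scale (c : K) (x : Q) : Q := quot_proj (c *: repr x).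

Lemma repr_quot_proj x : repr (quot_proj x) - x \in ideal_pred I.
Proof. by apply/ideal_predP/quot_projE; rewrite quot_projK. Qed.

Lemma quot_mulE x y : quot_mul (quot_proj x) (quot_proj y) = quot_proj (x * y).
Proof.
apply/quot_projE/ideal_predP; rewrite -(subrK (x * repr (quot_proj y)) (_ * _)).
rewrite -addrA -mulrBl -mulrBr rpredD //.
  exact/ideal_predMr/repr_quot_proj.
exact/ideal_predMl/repr_quot_proj.
Qed.

Lemma quot_scaleE c x : quot_scale c (quot_proj x) = quot_proj (c *: x).
Proof.
apply/quot_projE/ideal_predP; rewrite -scalerBr.
exact/ideal_predZ/repr_quot_proj.
Qed.

Lemma quot_ind (P : Q -> Prop) : (forall x, P (quot_proj x)) -> forall x, P x.
Proof. by move=> Pq x; rewrite -[x]quot_projK; apply: Pq. Qed.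

Lemma quot_mulA : associative quot_mul.
Proof.
by elim/quot_ind=> x; elim/quot_ind=> y; elim/quot_ind=> z; rewrite !quot_mulE mulrA.
Qed.

Lemma quot_mul1r : left_id quot_one quot_mul.
Proof. by elim/quot_ind=> x; rewrite quot_mulE mul1r. Qed.

Lemma quot_mulr1 : right_id quot_one quot_mul.
Proof. by elim/quot_ind=> x; rewrite quot_mulE mulr1. Qed.

Lemma quot_mulDl : left_distributive quot_mul +%R.
Proof.
elim/quot_ind=> x; elim/quot_ind=> y; elim/quot_ind=> z.
by rewrite -quot_projD !quot_mulE -quot_projD mulrDl.
Qed.

Lemma quot_mulDr : right_distributive quot_mul +%R.
Proof.
elim/quot_ind=> x; elim/quot_ind=> y; elim/quot_ind=> z.
by rewrite -quot_projD !quot_mulE -quot_projD mulrDr.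
Qed.

Lemma quot_one_neq0 : quot_one != 0.
Proof.
apply/eqP; rewrite -[0]quot_projK => /quot_projE I1; apply: (@in_ideal1 _ _ I).
suff <- : 1 - repr (0 : Q) + repr (0 : Q) = 1.
  apply: in_idealD => //; apply/ideal_predP; rewrite -[repr _]subr0.
  apply/ideal_predP/quot_projE; rewrite quot_projK.
  by apply: esym; exact: (raddf0 (\pi_Q%qT)).
by rewrite subrK.
Qed.

HB.instance Definition _ := GRing.Zmodule_isNzRing.Build Q
  quot_mulA quot_mul1r quot_mulr1 quot_mulDl quot_mulDr quot_one_neq0.

Lemma quot_scaleA a b (x : Q) :
  quot_scale a (quot_scale b x) = quot_scale (a * b) x.
Proof. by elim/quot_ind: x => x; rewrite !quot_scaleE scalerA. Qed.

Lemma quot_scale1r : left_id 1 quot_scale.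
Proof. by elim/quot_ind=> x; rewrite quot_scaleE scale1r. Qed.

Lemma quot_scaleDr : right_distributive quot_scale +%R.
Proof.
move=> c; elim/quot_ind=> x; elim/quot_ind=> y.
by rewrite -quot_projD !quot_scaleE -quot_projD scalerDr.
Qed.

Lemma quot_scaleDl (x : Q) :
  {morph quot_scale^~ x : a b / a + b >-> a + b}.
Proof.
by elim/quot_ind: x => x a b; rewrite !quot_scaleE -quot_projD scalerDl.
Qed.

HB.instance Definition _ := GRing.Zmodule_isLmodule.Build K Q
  quot_scaleA quot_scale1r quot_scaleDr quot_scaleDl.

Lemma quot_scaleAl (c : K) (x y : Q) : c *: (x * y) = (c *: x) * y.
Proof.
elim/quot_ind: x => x; elim/quot_ind: y => y.
by rewrite [LHS](congr1 (quot_scale c) (quot_mulE x y)) quot_scaleE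
  [RHS](congr1 (quot_mul^~ _) (quot_scaleE c x)) quot_mulE scalerAl.
Qed.

Lemma quot_scaleAr (c : K) (x y : Q) : c *: (x * y) = x * (c *: y).
Proof.
elim/quot_ind: x => x; elim/quot_ind: y => y.
by rewrite [LHS](congr1 (quot_scale c) (quot_mulE x y)) quot_scaleE
  [RHS](congr1 (quot_mul _) (quot_scaleE c y)) quot_mulE scalerAr.
Qed.

HB.instance Definition _ := GRing.Lmodule_isLalgebra.Build K Q quot_scaleAl.
HB.instance Definition _ := GRing.Lalgebra_isAlgebra.Build K Q quot_scaleAr.

End QuotAlgebra.

Inductive ideal_gen (K : fieldType) (A : algType K) (S : A -> Prop) : A -> Prop :=
| ideal_gen_base x : S x -> ideal_gen S x
| ideal_gen0 : ideal_gen S 0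
| ideal_genD x y : ideal_gen S x -> ideal_gen S y -> ideal_gen S (x + y)
| ideal_genMl a x : ideal_gen S x -> ideal_gen S (a * x)
| ideal_genMr a x : ideal_gen S x -> ideal_gen S (x * a).

(* Linearity of [lact^~ m] and of [ract m] says that [K] acts centrally:
   [lact k%:A m = k *: m = ract m k%:A]. *)
Record bimodule (K : fieldType) (A : algType K) := Bimodule {
  bimodule_carrier :> lmodType K;
  lact : A -> bimodule_carrier -> bimodule_carrier;
  ract : bimodule_carrier -> A -> bimodule_carrier;
  lact1 : forall m, lact 1 m = m;
  lactM : forall a b m, lact (a * b) m = lact a (lact b m);
  lact_linearl : forall m, linear (lact^~ m);
  lact_linearr : forall a, linear (lact a);
  ract1 : forall m, ract m 1 = m;
  ractM : forall a b m, ract m (a * b) = ract (ract m a) b;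
  ract_linearl : forall a, linear (ract^~ a);
  ract_linearr : forall m, linear (ract m);
  lract : forall a b m, ract (lact a m) b = lact a (ract m b)
}.

Section Ext.
Variables (K : fieldType) (A : algType K).
Implicit Types M N P : bimodule A.

Definition bimodule_hom M N (f : M -> N) : Prop :=
  [/\ linear f, forall a m, f (lact a m) = lact a (f m)
    & forall a m, f (ract m a) = ract (f m) a].

Definition surjective_map (S T : Type) (f : S -> T) : Prop :=
  forall t, exists s, f s = t.

Definition projective P : Prop :=
  forall M N (g : M -> N) (f : P -> N),
    bimodule_hom g -> surjective_map g -> bimodule_hom f ->
    exists2 h : P -> M, bimodule_hom h & forall p, g (h p) = f p.

Record projective_resolution M := ProjectiveResolution {
  res_obj :> nat -> bimodule A;
  res_diff : forall n, res_obj n.+1 -> res_obj n;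
  res_aug : res_obj 0 -> M;
  res_projective : forall n, projective (res_obj n);
  res_diff_hom : forall n, bimodule_hom (@res_diff n);
  res_aug_hom : bimodule_hom res_aug;
  res_exact : forall n (x : res_obj n.+1),
    res_diff x = 0 <-> exists y, x = res_diff (n := n.+1) y;
  res_exact0 : forall x : res_obj 0, res_aug x = 0 <-> exists y, x = res_diff y;
  res_aug_surj : surjective_map res_aug
}.

Definition ext_cocycle M N (P : projective_resolution M) n (f : P n -> N) :=
  bimodule_hom f /\ forall x : P n.+1, f (res_diff x) = 0.

Definition ext_coboundary M N (P : projective_resolution M) n :
    (P n -> N) -> Prop :=
  if n is m.+1 return (P n -> N) -> Prop then fun f =>
    exists2 g : P m -> N, bimodule_hom g & forall x, f x = g (res_diff x)
  else fun f => forall x, f x = 0.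

(* The [K]-space of [n]-cocycles modulo [n]-coboundaries has a basis with [d]
   elements. *)
Definition cohomology_dim M N (P : projective_resolution M) n d : Prop :=
  exists c : 'I_d -> P n -> N, (forall i, ext_cocycle (c i)) /\
    forall f : P n -> N, ext_cocycle f ->
      exists! a : 'rV[K]_d,
        ext_coboundary (fun x => f x - \sum_(i < d) a 0 i *: c i x).

(* [dim_K Ext^n(M, N) = d] in the category of bimodules: [Ext^n(M, N)] is the
   [n]-th cohomology of [Hom(P, N)] for a projective resolution [P] of [M]. The
   first conjunct excludes that the second one holds vacuously. *)
Definition Ext_dim n M N d : Prop :=
  inhabited (projective_resolution M) /\
  forall P : projective_resolution M, cohomology_dim N P n d.

Lemma regular_linearl (m : A) : linear ( *%R^~ m).
Proof. by move=> c a b; rewrite mulrDl scalerAl. Qed.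

Lemma regular_linearr (m : A) : linear ( *%R m).
Proof. by move=> c a b; rewrite mulrDr scalerAr. Qed.

Definition regular_bimodule : bimodule A :=
  @Bimodule K A A *%R *%R (@mul1r A) (fun a b m => esym (mulrA a b m))
    regular_linearl regular_linearr (@mulr1 A) (fun a b m => mulrA m a b)
    regular_linearl regular_linearr (fun a b m => esym (mulrA a m b)).

End Ext.

Definition HH_dim (K : fieldType) (A : algType K) (n d : nat) : Prop :=
  Ext_dim n (regular_bimodule A) (regular_bimodule A) d.

Inductive D4_vertex := V1 | V2 | V3 | V4.

Definition D4_vertex_code v : 'I_4 :=
  match v with V1 => inord 0 | V2 => inord 1 | V3 => inord 2 | V4 => inord 3 end.
Definition D4_vertex_decode (i : 'I_4) :=
  match val i with 0 => V1 | 1 => V2 | 2 => V3 | _ => V4 end.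
Lemma D4_vertex_codeK : cancel D4_vertex_code D4_vertex_decode.
Proof. by case; rewrite /D4_vertex_decode /= inordK. Qed.
HB.instance Definition _ := Finite.copy D4_vertex (can_type D4_vertex_codeK).

Inductive D4_arrow := alpha | beta | xi | epsilon | gamma | delta.

Definition D4_arrow_code a : 'I_6 :=
  match a with
  | alpha => inord 0 | beta => inord 1 | xi => inord 2
  | epsilon => inord 3 | gamma => inord 4 | delta => inord 5
  end.
Definition D4_arrow_decode (i : 'I_6) :=
  match val i with
  | 0 => alpha | 1 => beta | 2 => xi | 3 => epsilon | 4 => gamma | _ => delta
  end.
Lemma D4_arrow_codeK : cancel D4_arrow_code D4_arrow_decode.
Proof. by case; rewrite /D4_arrow_decode /= inordK. Qed.
HB.instance Definition _ := Finite.copy D4_arrow (can_type D4_arrow_codeK).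

Definition D4_source (a : D4_arrow) : D4_vertex :=
  match a with
  | alpha => V1 | xi => V2 | gamma => V3
  | beta | epsilon | delta => V4
  end.
Definition D4_target (a : D4_arrow) : D4_vertex :=
  match a with
  | beta => V1 | epsilon => V2 | delta => V3
  | alpha | xi | gamma => V4
  end.

Lemma D4_vertex_gt0 : (0 < #|{: D4_vertex}|)%N.
Proof. by apply/card_gt0P; exists V1. Qed.

Definition D4_quiver : quiver := Quiver D4_source D4_target D4_vertex_gt0.

Lemma arrow_walk (Q : quiver) (a : arrow Q) : walk (source a) [:: a].
Proof. by rewrite /= eqxx. Qed.

Definition arrow_path (Q : quiver) (a : arrow Q) : qpath Q :=
  exist (fun vs => walk vs.1 vs.2) (source a, [:: a]) (arrow_walk a).

Section StandardAlgebra.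
Variable K : fieldType.

Local Notation "[ a ]" := (path_elt K (@arrow_path D4_quiver a)).

Definition D4_relation (r : path_algebra K D4_quiver) : Prop :=
  [\/ r = [beta] * [alpha] + [delta] * [gamma] + [epsilon] * [xi],
      r = [gamma] * [delta], r = [xi] * [epsilon] | r = [alpha] * [beta]].

Lemma D4_ideal_trivial_coef (v : vertex D4_quiver) x :
  ideal_gen D4_relation x -> trivial_coef v x = 0.
Proof.
elim=> {x} [x|||a x _ x0|a x _ x0].
- have arr0 a : trivial_coef v [a] = 0.
    by rewrite trivial_coef_path; case: eqP => // /(congr1 (@path_arrows _)).
  by case=> ->; rewrite ?raddfD /= !trivial_coefM !arr0 ?mul0r ?addr0.
- exact: linear0.
- by move=> x y _ x0 _ y0; rewrite linearD /= x0 y0 addr0.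
- by rewrite trivial_coefM x0 mulr0.
- by rewrite trivial_coefM x0 mul0r.
Qed.

Lemma D4_ideal_proper : ~ ideal_gen D4_relation 1.
Proof.
move=> /(@D4_ideal_trivial_coef V1).
by rewrite trivial_coef1 => /eqP; rewrite oner_eq0.
Qed.

Definition D4_ideal : proper_ideal (path_algebra K D4_quiver) :=
  @ProperIdeal K (path_algebra K D4_quiver) (ideal_gen D4_relation)
    (ideal_gen0 _) (@ideal_genD _ _ _) (@ideal_genMl _ _ _)
    (@ideal_genMr _ _ _) D4_ideal_proper.

Definition standard_algebra := quot_algebra D4_ideal.
HB.instance Definition _ := GRing.Algebra.on standard_algebra.

End StandardAlgebra.

(* Main.v *)
Require Import Defs.
From HB Require Import structures.
From mathcomp Require Import all_boot all_order all_algebra.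
From mathcomp Require Import finmap boolp monalg.

Set Implicit Arguments.
Unset Strict Implicit.
Unset Printing Implicit Defensive.

Import GRing.Theory.
Local Open Scope ring_scope.

(** Let [A] be the standard algebra, [e_i] its idempotent at the vertex [i], and
    for a list [G] of labels, each with a source [i] and a target [j], let
    [P(G)] be the direct sum over [G] of the projective bimodules
    [A e_i (x) e_j A].  In characteristic 2 the algebra is symmetric and its
    third syzygy as a bimodule is [A] itself, so that it has a projective
    bimodule resolution of period 3, with [P(vertices)], [P(arrows)],
    [P(vertices)] in degrees 0, 1, 2.  Any projective resolution computes the
    same cohomology ([cohomology_dim_indep]), so it suffices to know the
    degree 2 cohomology of this one.

    Basis.  Orienting the relation at the vertex 4 as
    [epsilon xi -> beta alpha + delta gamma] and completing it with the three
    monomial relations gives a rewriting system with 28 irreducible paths, the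
    [normal_words].  They span [A].  They are independent because the path
    algebra acts on the space that they freely span, by multiplication followed
    by rewriting, and the relations act as zero ([act_ideal]).  All structure
    constants in this basis are 0 or 1.  Hence every map below is given by a
    function from words to lists of words, and, as [2 = 0], two lists have the
    same sum as soon as each entry of their concatenation occurs an even number
    of times ([even_multiplicity_eq]).  Identities between such maps become
    finite computations with lists.

    Resolution.  The first differential sends an arrow [a : i -> j] to
    [a (x) e_j + e_i (x) a].  The second sends the generator at a vertex [k] to
    the sum of [e_k (x) b + a (x) e_k] over the terms [a b] of the relation at
    [k], with the first summand at the label [a] and the second one at [b].  The
    third sends the generator at [i] to the sum of [p (x) p'] over the words [p]
    starting at [i] and their duals [p'] for the symmetrizing form that reads
    off the coefficients at the socle.  It is the augmentation followed by an
    embedding of [A] onto the kernel of the second differential.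
    Exactness holds because of a contracting homotopy that is linear for the
    left action ([contraction0] to [contraction3]).

    Degree 2.  A 2-cochain is a family of loops in the [e_i A e_i].  These
    spaces have the bases [e_i], [s_i] for [i = 1, 2, 3] and [e_4],
    [beta alpha], [delta gamma], [s_4] for [i = 4], where [s_i] spans the socle
    at [i].  The third differential evaluates such a family at [i] to [s_i]
    times the sum over [j] of the dimension of [e_i A e_j] times the coefficient
    of [e_j].  Modulo 2 these dimensions are 1 exactly for two distinct outer
    vertices, so the cocycles are the families whose coefficients of [e_1],
    [e_2], [e_3] agree.  The coboundaries are spanned by [beta alpha],
    [delta gamma] and the [s_i + s_4].  Three invariants of a cocycle remain:
    the coefficients of [e_1] and of [e_4], and the sum of the four socle
    coefficients.  They vanish on coboundaries ([invariant_coboundary]), a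
    cocycle on which they vanish is a coboundary
    ([zero_invariants_coboundary]), and they are dual to three explicit cocycles
    ([invariant_class]). *)

(** * Cohomology is independent of the projective resolution *)

Section LinearMap.
Variables (K : fieldType) (U V : lmodType K) (f : U -> V).
Hypothesis fL : linear f.

Lemma lin_add x y : f (x + y) = f x + f y.
Proof. by rewrite -[x]scale1r fL !scale1r. Qed.

Lemma lin_zero : f 0 = 0.
Proof. by apply: (addrI (f 0)); rewrite -lin_add !addr0. Qed.

Lemma lin_scale c x : f (c *: x) = c *: f x.
Proof. by rewrite -[c *: x]addr0 fL lin_zero addr0. Qed.

Lemma lin_sub x y : f (x - y) = f x - f y.
Proof. by rewrite lin_add -scaleN1r lin_scale scaleN1r. Qed.

Lemma lin_sum I (r : seq I) (F : I -> U) :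
  f (\sum_(i <- r) F i) = \sum_(i <- r) f (F i).
Proof. exact: (big_morph f lin_add lin_zero). Qed.

End LinearMap.

Lemma lin_comb (K : fieldType) (U V : lmodType K) c (f g : U -> V) :
  linear f -> linear g -> linear (fun x => c *: f x + g x).
Proof.
move=> fL gL k x y; rewrite fL gL !scalerDr !scalerA mulrC !addrA.
by congr (_ + _); rewrite -!addrA; congr (_ + _); rewrite addrC.
Qed.

Lemma lin_comp (K : fieldType) (U V W : lmodType K) (f : V -> W) (g : U -> V) :
  linear f -> linear g -> linear (fun x => f (g x)).
Proof. by move=> fL gL c x y; rewrite gL fL. Qed.

Section BimoduleHom.
Variables (K : fieldType) (A : algType K).
Implicit Types M N P : bimodule A.

Lemma hom_comp M N P (g : N -> P) (f : M -> N) :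
  bimodule_hom g -> bimodule_hom f -> bimodule_hom (fun x => g (f x)).
Proof.
move=> [gL gl gr] [fL fl fr]; split=> [|a m|a m]; first exact: lin_comp.
- by rewrite fl gl.
- by rewrite fr gr.
Qed.

Lemma hom_linear M N (f : M -> N) : bimodule_hom f -> linear f.
Proof. by case. Qed.

Lemma homB M N (f : M -> N) : bimodule_hom f -> {morph f : x y / x - y}.
Proof. by case=> fL _ _; apply: lin_sub. Qed.

Lemma homD M N (f : M -> N) : bimodule_hom f -> {morph f : x y / x + y}.
Proof. by case=> fL _ _; apply: lin_add. Qed.

Lemma hom0 M N (f : M -> N) : bimodule_hom f -> f 0 = 0.
Proof. by case=> fL _ _; apply: lin_zero. Qed.

Lemma hom_zero M N : bimodule_hom (fun _ : M => 0 : N).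
Proof.
split=> [c x y|a m|a m]; first by rewrite scaler0 addr0.
- by rewrite (lin_zero (lact_linearr a)).
- by rewrite (lin_zero (ract_linearl a)).
Qed.

Lemma hom_lin M N c (f g : M -> N) :
  bimodule_hom f -> bimodule_hom g -> bimodule_hom (fun x => c *: f x + g x).
Proof.
move=> [fL fl fr] [gL gl gr]; split=> [|a m|a m]; first exact: lin_comb.
- by rewrite fl gl lact_linearr.
- by rewrite fr gr ract_linearl.
Qed.

Lemma hom_sub M N (f g : M -> N) :
  bimodule_hom f -> bimodule_hom g -> bimodule_hom (fun x => f x - g x).
Proof.
move=> hf hg; have -> : (fun x => f x - g x) = (fun x => -1 *: g x + f x).
  by apply/funext => x; rewrite scaleN1r addrC.
exact: hom_lin.
Qed.

Lemma hom_comb M N (I : eqType) (r : seq I) (a : I -> K) (c : I -> M -> N) :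
  (forall i, i \in r -> bimodule_hom (c i)) ->
  bimodule_hom (fun x => \sum_(i <- r) a i *: c i x).
Proof.
rewrite unlock; elim: r => [|i r IHr] hc; first exact: hom_zero.
apply: hom_lin; first by apply: hc; rewrite mem_head.
by apply: IHr => j rj; apply: hc; rewrite inE rj orbT.
Qed.

End BimoduleHom.

(** Projectivity gives liftings along surjections.  To lift along a map whose image
    is only known to contain the values to be lifted, the image has to be made a
    bimodule. *)
Section SubBimodule.
Variables (K : fieldType) (A : algType K) (N : bimodule A) (S : pred N).
Hypotheses (S_submod : submod_closed S)
  (S_lact : forall a x, x \in S -> lact a x \in S)
  (S_ract : forall a x, x \in S -> ract x a \in S).

HB.instance Definition _ := GRing.isSubmodClosed.Build K N S S_submod.

Record sub_carrier := SubCarrier { sub_val :> N; sub_valP : sub_val \in S }.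
HB.instance Definition _ := [isSub for sub_val].
HB.instance Definition _ := [Choice of sub_carrier by <:].
HB.instance Definition _ := [SubChoice_isSubLmodule of sub_carrier by <:].

Definition sub_lact a (x : sub_carrier) := SubCarrier (S_lact a (sub_valP x)).
Definition sub_ract (x : sub_carrier) a := SubCarrier (S_ract a (sub_valP x)).

Definition sub_bimodule : bimodule A.
Proof.
refine (@Bimodule K A sub_carrier sub_lact sub_ract _ _ _ _ _ _ _ _ _);
  do ?move=> ? ; apply: val_inj => /=.
- exact: lact1.
- exact: lactM.
- exact: lact_linearl.
- exact: lact_linearr.
- exact: ract1.
- exact: ractM.
- exact: ract_linearl.
- exact: ract_linearr.
- exact: lract.
Defined.

End SubBimodule.

Section Lifting.
Variables (K : fieldType) (A : algType K).
Implicit Types M N P : bimodule A.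

Lemma projective_lift_image M N P (g : M -> N) (f : P -> N) :
  projective P -> bimodule_hom g -> bimodule_hom f ->
  (forall p, exists m, f p = g m) ->
  exists2 h : P -> M, bimodule_hom h & forall p, f p = g (h p).
Proof.
move=> Pproj hg hf f_im.
have [gL gl gr] := hg; have [fL fl fr] := hf.
pose S : pred N := fun x => `[< exists m, x = g m >].
have Sg m : g m \in S by apply/asboolP; exists m.
have Sf p : f p \in S by apply/asboolP.
have S_submod : submod_closed S.
  split=> [|c x y /asboolP[m ->] /asboolP[m' ->]]; first by rewrite -(hom0 hg).
  by rewrite -gL.
have S_lact a x : x \in S -> lact a x \in S.
  by move=> /asboolP[m ->]; rewrite -gl.
have S_ract a x : x \in S -> ract x a \in S.
  by move=> /asboolP[m ->]; rewrite -gr.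
pose I := sub_bimodule S_submod S_lact S_ract.
pose g' m : I := SubCarrier (Sg m); pose f' p : I := SubCarrier (Sf p).
have hg' : bimodule_hom g'.
  by split=> [c x y|a x|a x]; apply: val_inj; [exact: gL | exact: gl | exact: gr].
have hf' : bimodule_hom f'.
  by split=> [c x y|a x|a x]; apply: val_inj; [exact: fL | exact: fl | exact: fr].
have g'_surj : surjective_map g'.
  move=> [x Sx]; have /asboolP[m e] := Sx.
  by exists m; apply: val_inj; rewrite /= e.
have [h hh e] := Pproj _ _ g' f' hg' g'_surj hf'.
by exists h => // p; have /(congr1 val) := e p.
Qed.

End Lifting.

Section Comparison.
Variables (K : fieldType) (A : algType K) (M : bimodule A).

Lemma res_diffK (P : projective_resolution M) n (x : P n.+2) :
  res_diff (res_diff x) = 0.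
Proof. by apply/res_exact; exists x. Qed.

Definition chain_map (P Q : projective_resolution M) (u : forall n, P n -> Q n) :=
  (forall n, bimodule_hom (u n)) /\
  forall n (x : P n.+1), u n (res_diff x) = res_diff (u n.+1 x).

(** Liftings are built degree by degree.  The next one exists because the
    previous one maps boundaries to boundaries, so this property is carried along
    in the induction. *)
Lemma chain_map_exists (P Q : projective_resolution M) :
  exists2 u : forall n, P n -> Q n, chain_map u &
    forall x, res_aug (u 0 x) = res_aug x.
Proof.
pose good n (f : P n -> Q n) :=
  bimodule_hom f /\ forall x : P n.+1, exists y, f (res_diff x) = res_diff y.
have step n (f : {f | @good n f}) : {f' | @good n.+1 f' /\
    forall x, sval f (res_diff x) = res_diff (f' x)}.
  case: f => f /= [hf f_im]; apply: cid.
  have [f' hf' e] := projective_lift_image (@res_projective _ _ _ P n.+1)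
    (res_diff_hom Q n) (hom_comp hf (res_diff_hom P n)) f_im.
  exists f'; split=> //; split=> // x.
  by apply/res_exact; rewrite -e res_diffK (hom0 hf).
have start : {f | @good 0 f /\ forall x, res_aug (f x) = res_aug x}.
  apply: cid; have [f hf e] := res_projective (res_aug_hom Q) (res_aug_surj Q)
    (res_aug_hom P).
  exists f; split=> //; split=> // x.
  by apply/res_exact0; rewrite e; apply/res_exact0; exists x.
pose u n : {f | @good n f} := nat_rect (fun n => {f | @good n f})
  (exist _ (sval start) (proj1 (svalP start)))
  (fun n f => exist _ (sval (step n f)) (proj1 (svalP (step n f)))) n.
exists (fun n => sval (u n)); last exact: (svalP start).2.
by split=> [n|n x]; [exact: (svalP (u n)).1 | exact: (svalP (step n (u n))).2].
Qed.

(** The obstruction [u - s d] to the next step is a cycle, hence a boundary; its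
    being a cycle is again the induction invariant. *)
Lemma null_homotopy (P Q : projective_resolution M) (u : forall n, P n -> Q n) :
  chain_map u -> (forall x, res_aug (u 0 x) = 0) ->
  exists s : forall n, P n -> Q n.+1, [/\ forall n, bimodule_hom (s n),
    forall x, u 0 x = res_diff (s 0 x) &
    forall n x, u n.+1 x = res_diff (s n.+1 x) + s n (res_diff x)].
Proof.
move=> [hu ud] u0.
pose good n (s : P n -> Q n.+1) := bimodule_hom s /\
  forall x : P n.+1, res_diff (u n.+1 x - s (res_diff x)) = 0.
have step n (s : {s | @good n s}) : {s' | @good n.+1 s' /\
    forall x, u n.+1 x = res_diff (s' x) + sval s (res_diff x)}.
  case: s => s /= [hs ds]; apply: cid.
  have [||s' hs' e] := projective_lift_image (@res_projective _ _ _ P n.+1)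
    (res_diff_hom Q n.+1) (f := fun x => u n.+1 x - s (res_diff x)).
  - exact/hom_sub/hom_comp/res_diff_hom.
  - by move=> x; apply/res_exact.
  have e' x : u n.+1 x = res_diff (s' x) + s (res_diff x) by rewrite -e subrK.
  exists s'; split=> //; split=> // x.
  rewrite (homB (res_diff_hom Q _)) -ud e' res_diffK (hom0 hs) addr0 subrr.
  by [].
have start : {s | @good 0 s /\ forall x, u 0 x = res_diff (s x)}.
  apply: cid.
  have [|s hs e] := projective_lift_image (@res_projective _ _ _ P 0)
    (res_diff_hom Q 0) (hu 0); first by move=> x; apply/res_exact0.
  exists s; split=> //; split=> // x.
  by rewrite (homB (res_diff_hom Q _)) -ud -e subrr.
pose s n : {s | @good n s} := nat_rect (fun n => {s | @good n s})
  (exist _ (sval start) (proj1 (svalP start)))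
  (fun n f => exist _ (sval (step n f)) (proj1 (svalP (step n f)))) n.
exists (fun n => sval (s n)); split=> [n||n x].
- exact: (svalP (s n)).1.
- exact: (svalP start).2.
- exact: (svalP (step n (s n))).2.
Qed.

Lemma coboundary_lin (N : bimodule A) (P : projective_resolution M) n c
    (f g : P n -> N) :
  ext_coboundary f -> ext_coboundary g -> ext_coboundary (fun x => c *: f x + g x).
Proof.
case: n f g => [|n] f g /=.
  by move=> f0 g0 x; rewrite f0 g0 scaler0 addr0.
move=> [f' hf' ef] [g' hg' eg]; exists (fun x => c *: f' x + g' x).
  exact: hom_lin.
by move=> x; rewrite ef eg.
Qed.

Lemma coboundary_comp (N : bimodule A) (P Q : projective_resolution M)
    (u : forall n, P n -> Q n) n (f : Q n -> N) :
  chain_map u -> ext_coboundary f -> ext_coboundary (fun x => f (u n x)).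
Proof.
move=> [hu ud]; case: n f => [|n] f /=; first by move=> f0 x; apply: f0.
move=> [g hg e]; exists (fun x => g (u n x)); first exact: hom_comp.
by move=> x; rewrite e ud.
Qed.

Lemma cocycle_comp (N : bimodule A) (P Q : projective_resolution M)
    (u : forall n, P n -> Q n) n (f : Q n -> N) :
  chain_map u -> ext_cocycle f -> ext_cocycle (fun x => f (u n x)).
Proof.
move=> [hu ud] [hf f0]; split; first exact: hom_comp.
by move=> x; rewrite ud f0.
Qed.

(** Such an endomorphism [u] is homotopic to the identity, [u - 1 = d s + s d], and
    a cocycle kills the term [d s]. *)
Lemma endo_cocycle (N : bimodule A) (P : projective_resolution M)
    (u : forall n, P n -> P n) n (f : P n -> N) :
  chain_map u -> (forall x, res_aug (u 0 x) = res_aug x) ->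
  ext_cocycle f -> ext_coboundary (fun x => f (u n x) - f x).
Proof.
move=> [hu ud] u0 [hf f0].
have [||s [hs e0 eS]] := @null_homotopy P P (fun n x => u n x - x).
- split=> [m|m x]; first exact/hom_sub.
  by rewrite (homB (res_diff_hom P m)) ud.
- by move=> x; rewrite (homB (res_aug_hom P)) u0 subrr.
case: n f hf f0 => [|n] f hf f0 /=.
  by move=> x; rewrite -(homB hf) e0 f0.
exists (fun x => f (s n x)); first exact: hom_comp.
by move=> x; rewrite -(homB hf) eS (homD hf) f0 add0r.
Qed.

(** Chain maps [u] and [v] in both directions over the identity transport cocycles,
    and [v u] and [u v] act on classes as the identity. *)
Lemma cohomology_dim_indep (N : bimodule A) (P Q : projective_resolution M) n d :
  cohomology_dim N Q n d -> cohomology_dim N P n d.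
Proof.
move=> [c [hc c_basis]].
have [u hu u0] := chain_map_exists P Q; have [v hv v0] := chain_map_exists Q P.
have huv : chain_map (fun n x => v n (u n x)).
  split=> [m|m x]; first exact: hom_comp (hv.1 m) (hu.1 m).
  by rewrite hu.2 hv.2.
have hvu : chain_map (fun n x => u n (v n x)).
  split=> [m|m x]; first exact: hom_comp (hu.1 m) (hv.1 m).
  by rewrite hv.2 hu.2.
exists (fun i x => c i (u n x)); split=> [i|f hf].
  exact: cocycle_comp hu (hc i).
have [a [ha a_uniq]] := c_basis _ (cocycle_comp hv hf).
exists a; split.
  have := coboundary_lin (-1) (endo_cocycle huv (fun x => etrans (v0 _) (u0 _)) hf)
    (coboundary_comp hu ha).
  congr ext_coboundary; apply/funext => x.
  by rewrite scaleN1r opprB addrA subrK.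
move=> b hb; apply: a_uniq.
have hcomb : ext_cocycle (fun x => \sum_(i < d) b 0 i *: c i x).
  split; first by apply: hom_comb => i _; exact: (hc i).1.
  by move=> x; rewrite big1 // => i _; rewrite (hc i).2 scaler0.
have := coboundary_lin 1 (endo_cocycle hvu (fun x => etrans (u0 _) (v0 _)) hcomb)
  (coboundary_comp hv hb).
congr ext_coboundary; apply/funext => x.
by rewrite scale1r addrC addrA subrK.
Qed.

End Comparison.

(** * Normal words and the rewriting of their products *)

(** The equality tests on vertices, arrows and words are written by cases so that
    the verifications on lists of words reduce to a Boolean by evaluation. *)
Definition vertex_eqb (u v : D4_vertex) : bool :=
  match u, v with
  | V1, V1 | V2, V2 | V3, V3 | V4, V4 => true
  | _, _ => false
  end.

Definition arrow_eqb (a b : D4_arrow) : bool :=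
  match a, b with
  | alpha, alpha | beta, beta | xi, xi | epsilon, epsilon
  | gamma, gamma | delta, delta => true
  | _, _ => false
  end.

Fixpoint arrows_eqb (s t : seq D4_arrow) : bool :=
  match s, t with
  | [::], [::] => true
  | a :: s', b :: t' => if arrow_eqb a b then arrows_eqb s' t' else false
  | _, _ => false
  end.

Lemma vertex_eqbE u v : vertex_eqb u v = (u == v).
Proof. by apply/idP/eqP => [|->]; [case: u v => -[] | case: v]. Qed.

Lemma arrow_eqbE a b : arrow_eqb a b = (a == b).
Proof. by apply/idP/eqP => [|->]; [case: a b => -[] | case: b]. Qed.

Lemma arrows_eqbE s t : arrows_eqb s t = (s == t).
Proof.
by elim: s t => [|a s IHs] [|b t] //=; rewrite arrow_eqbE IHs eqseq_cons; case: eqP.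
Qed.

(** The raw data of a path: a starting vertex and a list of arrows, composable or
    not. *)
Definition word := (D4_vertex * seq D4_arrow)%type.
Implicit Types (p q g : word) (a b : D4_arrow) (v : D4_vertex).

Definition word_eqb (p q : word) : bool :=
  if vertex_eqb p.1 q.1 then arrows_eqb p.2 q.2 else false.

Lemma word_eqbE p q : word_eqb p q = (p == q).
Proof.
rewrite /word_eqb vertex_eqbE arrows_eqbE; case: p q => [v s] [u t].
by rewrite xpair_eqE; case: eqP.
Qed.

Fixpoint word_mem p (s : seq word) : bool :=
  if s is q :: s' then if word_eqb p q then true else word_mem p s' else false.

Lemma word_memE p s : word_mem p s = (p \in s).
Proof. by elim: s => //= q s IHs; rewrite word_eqbE IHs inE; case: eqP. Qed.

Definition word_target p : D4_vertex := foldl (fun _ a => D4_target a) p.1 p.2.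

Definition vertex_word v : word := (v, [::]).
Definition arrow_word a : word := (D4_source a, [:: a]).

Definition vertices := [:: V1; V2; V3; V4].
Definition arrows := [:: alpha; beta; xi; epsilon; gamma; delta].

Lemma mem_vertices v : v \in vertices.
Proof. by rewrite !inE -!vertex_eqbE; case: v. Qed.

Lemma mem_arrows a : a \in arrows.
Proof. by rewrite !inE -!arrow_eqbE; case: a. Qed.

(** The 28 paths that contain no left-hand side of the rewriting system: 6 start at
    each of the vertices 1, 2, 3 and 10 at the vertex 4. *)
Definition normal_words : seq word :=
  map vertex_word vertices ++ map arrow_word arrows ++
  [:: (V1, [:: alpha; epsilon]); (V1, [:: alpha; delta]);
      (V2, [:: xi; beta]); (V2, [:: xi; delta]);
      (V3, [:: gamma; beta]); (V3, [:: gamma; epsilon]);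
      (V4, [:: beta; alpha]); (V4, [:: delta; gamma]);
      (V1, [:: alpha; delta; gamma]); (V2, [:: xi; beta; alpha]);
      (V3, [:: gamma; beta; alpha]);
      (V4, [:: delta; gamma; beta]); (V4, [:: beta; alpha; epsilon]);
      (V4, [:: beta; alpha; delta]);
      (V1, [:: alpha; delta; gamma; beta]); (V2, [:: xi; beta; alpha; epsilon]);
      (V3, [:: gamma; beta; alpha; delta]); (V4, [:: beta; alpha; delta; gamma])].

(** Apart from the oriented relation at 4, these rules are its consequences by
    multiplication with arrows and by the monomial relations.  Every other
    composable product of a normal word and an arrow is normal or zero. *)
Definition reduct_of (w : seq D4_arrow) : seq word :=
  match w with
  | [:: epsilon; xi] => [:: (V4, [:: beta; alpha]); (V4, [:: delta; gamma])]
  | [:: alpha; epsilon; xi] => [:: (V1, [:: alpha; delta; gamma])]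
  | [:: gamma; epsilon; xi] => [:: (V3, [:: gamma; beta; alpha])]
  | [:: xi; delta; gamma] => [:: (V2, [:: xi; beta; alpha])]
  | [:: delta; gamma; epsilon] => [:: (V4, [:: beta; alpha; epsilon])]
  | [:: delta; gamma; beta; alpha] | [:: beta; alpha; epsilon; xi] =>
      [:: (V4, [:: beta; alpha; delta; gamma])]
  | _ => [::]
  end.

Definition word_mul_arrow p a : seq word :=
  if word_mem p normal_words then
    if vertex_eqb (word_target p) (D4_source a) then
      let w := rcons p.2 a in
      if word_mem (p.1, w) normal_words then [:: (p.1, w)] else reduct_of w
    else [::]
  else [::].

(** Rewriting after each appended arrow suffices, because a normal word followed by
    one arrow reduces to a sum of normal words in one step. *)
Definition word_mul p q : seq word :=
  if vertex_eqb (word_target p) q.1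
  then foldl (fun s a => flatten [seq word_mul_arrow x a | x <- s]) [:: p] q.2
  else [::].

Lemma mul2_char2 (K : fieldType) (V : lmodType K) (x : V) :
  2%N \in [pchar K] -> x *+ 2 = 0.
Proof. by move=> char2; rewrite -scaler_nat (pcharf0 char2) scale0r. Qed.

Section Parity.
Variables (T : eqType) (eqb : rel T).
Hypothesis eqbE : eqb =2 eq_op.

Definition even_multiplicity (s : seq T) :=
  all (fun x => ~~ odd (count (eqb x) s)) s.

(** Equal summands cancel in pairs. *)
Lemma even_multiplicity_sum (K : fieldType) (V : lmodType K) (F : T -> V) s :
  2%N \in [pchar K] -> even_multiplicity s -> \sum_(x <- s) F x = 0.
Proof.
move=> char2 /allP s_even.
rewrite -big_undup_iterop_count big_seq big1 // => x.
rewrite mem_undup => /s_even.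
have -> : count (eqb x) s = count_mem x s.
  by apply: eq_count => y; rewrite eqbE eq_sym.
move=> /negbTE x_even; rewrite -[iterop _ _ _ _]/(F x *+ count_mem x s).
rewrite -[count_mem x s]odd_double_half x_even.
by rewrite add0n -mul2n mulrnA (mul2_char2 _ char2) mul0rn.
Qed.

Lemma even_multiplicity_eq (K : fieldType) (V : lmodType K) (F : T -> V) s t :
  2%N \in [pchar K] -> even_multiplicity (s ++ t) ->
  \sum_(x <- s) F x = \sum_(x <- t) F x.
Proof.
move=> char2 /(even_multiplicity_sum F char2); rewrite big_cat /= => /eqP.
rewrite addr_eq0 => /eqP ->; apply/eqP.
by rewrite -subr_eq0 -opprD oppr_eq0 -mulr2n (mul2_char2 _ char2).
Qed.

End Parity.

Lemma normal_ind (P : word -> Prop) :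
  foldr (fun p Q => P p /\ Q) True normal_words ->
  forall p, p \in normal_words -> P p.
Proof.
elim: normal_words => //= q s IHs [Pq Ps] p; rewrite inE => /predU1P[->//|].
exact: IHs.
Qed.

(** Any elements satisfying the relations of the quiver satisfy the rewriting
    rules, so the rules are derived in an arbitrary algebra. *)
Section WordValues.
Variables (K : fieldType) (R : algType K).
Variables (e : D4_vertex -> R) (ar : D4_arrow -> R).
Hypothesis char2 : 2%N \in [pchar K].
Hypothesis e_idem : forall u v, e u * e v = if vertex_eqb u v then e u else 0.
Hypothesis e_ar : forall a, e (D4_source a) * ar a = ar a.
Hypothesis ar_e : forall a, ar a * e (D4_target a) = ar a.
Hypothesis rel4 : ar beta * ar alpha + ar delta * ar gamma + ar epsilon * ar xi = 0.
Hypothesis rel3 : ar gamma * ar delta = 0.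
Hypothesis rel2 : ar xi * ar epsilon = 0.
Hypothesis rel1 : ar alpha * ar beta = 0.

Definition value p : R := e p.1 * \prod_(a <- p.2) ar a.

Lemma value_rcons v w a : value (v, rcons w a) = value (v, w) * ar a.
Proof. by rewrite /value /= big_rcons mulrA. Qed.

Lemma value_tgt p : value p * e (word_target p) = value p.
Proof.
case: p => v w; case/lastP: w => [|w a].
  by rewrite /value big_nil mulr1 /word_target /= e_idem; case: v.
by rewrite value_rcons /word_target /= foldl_rcons -mulrA ar_e.
Qed.

Lemma value_rcons_eq0 p a :
  ~~ vertex_eqb (word_target p) (D4_source a) -> value p * ar a = 0.
Proof.
by move=> /negbTE ne; rewrite -value_tgt -e_ar mulrA -(mulrA (value p)) e_idem ne
  mulr0 mul0r.
Qed.

Lemma oppr_char2 (x : R) : - x = x.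
Proof.
by apply/eqP; rewrite -subr_eq0 -opprD oppr_eq0 -mulr2n mul2_char2.
Qed.

Local Notation "'α'" := (ar alpha).
Local Notation "'β'" := (ar beta).
Local Notation "'ξ'" := (ar xi).
Local Notation "'ε'" := (ar epsilon).
Local Notation "'γ'" := (ar gamma).
Local Notation "'δ'" := (ar delta).

Lemma eq_char2 (x y : R) : x + y = 0 -> x = y.
Proof. by move/eqP; rewrite addr_eq0 oppr_char2 => /eqP. Qed.

Lemma rel_ex : ε * ξ = β * α + δ * γ.
Proof. by apply: esym; apply: eq_char2. Qed.

Lemma rel_aex : α * (ε * ξ) = α * (δ * γ).
Proof. by rewrite rel_ex mulrDr (mulrA α β) rel1 mul0r add0r. Qed.

Lemma rel_gex : γ * (ε * ξ) = γ * (β * α).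
Proof. by rewrite rel_ex mulrDr (mulrA γ δ) rel3 mul0r addr0. Qed.

(** Expand [0 = xi epsilon xi] with the relation at 4; the next rule comes from
    [0 = epsilon xi epsilon] in the same way. *)
Lemma rel_xdg : ξ * (δ * γ) = ξ * (β * α).
Proof. by apply: esym; apply: eq_char2; rewrite -mulrDr -rel_ex mulrA rel2 mul0r. Qed.

Lemma rel_dge : δ * (γ * ε) = β * (α * ε).
Proof.
apply: esym; apply: eq_char2.
by rewrite !mulrA -mulrDl -rel_ex -mulrA rel2 mulr0.
Qed.

Lemma rel_dgba : δ * (γ * (β * α)) = β * (α * (δ * γ)).
Proof.
by rewrite -rel_gex !mulrA -(mulrA δ) rel_dge -!mulrA rel_aex.
Qed.

Lemma rel_xbad : ξ * (β * (α * δ)) = 0.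
Proof. by rewrite !mulrA -(mulrA ξ) -rel_xdg -!mulrA rel3 !mulr0. Qed.

Lemma rel_xbadg : ξ * (β * (α * (δ * γ))) = 0.
Proof.
have <- : ξ * (β * (α * δ)) * γ = ξ * (β * (α * (δ * γ))) by rewrite -!mulrA.
by rewrite rel_xbad mul0r.
Qed.

Lemma rel_gbae : γ * (β * (α * ε)) = 0.
Proof. by rewrite -rel_dge mulrA rel3 mul0r. Qed.

Lemma rel_badgb : β * (α * (δ * (γ * β))) = 0.
Proof.
have <- : β * (α * (δ * γ)) * β = β * (α * (δ * (γ * β))) by rewrite -!mulrA.
by rewrite -rel_dgba -!mulrA rel1 !mulr0.
Qed.

(** A case for each of the 28 normal words and each composable arrow; the cases
    left after the monomial relations are the rules above. *)
Lemma value_reduct_of p a : p \in normal_words ->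
  vertex_eqb (word_target p) (D4_source a) ->
  word_mem (p.1, rcons p.2 a) normal_words = false ->
  value p * ar a = \sum_(q <- reduct_of (rcons p.2 a)) value q.
Proof.
move=> np; move: p np a; apply: normal_ind.
rewrite [foldr _ _ _]/=; do !split; case=> //=; move=> _ _;
  rewrite /value !(big_cons, big_nil) /= ?mulr1 ?addr0 -?mulrA;
  rewrite ?(rel1, rel2, rel3, mulr0) //.
- by rewrite rel_ex mulrDr.
- by rewrite rel_aex.
- by rewrite rel_xdg.
- by rewrite rel_gex.
- by rewrite rel_dge.
- by rewrite rel_dge (mulrA α) rel1 mul0r mulr0.
- by rewrite rel_xbad mulr0.
- by rewrite rel_gbae mulr0.
- by rewrite rel_dgba.
- by rewrite rel_aex.
- by rewrite rel_dgba (mulrA α) rel1 mul0r mulr0.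
- by rewrite rel_aex rel_xbadg mulr0.
- by rewrite -rel_dgba (mulrA γ) rel3 mul0r mulr0.
- by rewrite rel_badgb mulr0.
- by rewrite rel_dge (mulrA α) rel1 mul0r !mulr0.
Qed.

Lemma value_mul_arrow p a : p \in normal_words ->
  value p * ar a = \sum_(q <- word_mul_arrow p a) value q.
Proof.
move=> np; rewrite /word_mul_arrow word_memE np.
case: ifPn => [tgt_a|/value_rcons_eq0 -> //]; last by rewrite big_nil.
case: ifPn => [_|/negbTE nn]; first by rewrite big_seq1 value_rcons; case: (p).
exact: value_reduct_of.
Qed.

End WordValues.

Section LinearExt.
Variables (K : fieldType) (B : choiceType) (V : lmodType K).

Lemma malg_ext (f g : {malg K[B]} -> V) : linear f -> linear g ->
  (forall i, f << i >> = g << i >>) -> f =1 g.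
Proof.
move=> fL gL fg x; rewrite [x]monalgE (lin_sum fL) (lin_sum gL).
apply: eq_bigr => i _; have -> : << x@_i *g i >> = x@_i *: << i >> :> {malg K[B]}.
  by apply/malgP => j; rewrite mcoeffZ !mcoeffU mulr_natr.
by rewrite (lin_scale fL) (lin_scale gL) fg.
Qed.

Lemma lin_ext_linear (F : B -> V) : linear (lin_ext F).
Proof. exact: linearP. Qed.

End LinearExt.

Section Standard.
Variable K : fieldType.
Hypothesis char2 : 2%N \in [pchar K].

Local Notation PA := (path_algebra K D4_quiver).
Local Notation SA := (standard_algebra K).
Local Notation pr := (@quot_proj K PA (D4_ideal K)).

Lemma prD : {morph pr : x y / x + y}. Proof. exact: quot_projD. Qed.

Lemma prM : {morph pr : x y / x * y}.
Proof. by move=> x y; apply: esym; apply: quot_mulE. Qed.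

Lemma prZ c x : pr (c *: x) = c *: pr x.
Proof. by apply: esym; apply: quot_scaleE. Qed.

Lemma pr_linear : linear pr.
Proof. by move=> c x y; rewrite prD prZ. Qed.

Lemma pr_eq0 x : ideal_gen (@D4_relation K) x -> pr x = 0.
Proof.
move=> Ix; rewrite -(lin_zero pr_linear); apply/quot_projE.
by rewrite subr0.
Qed.

Definition vertex_elt v : SA := pr (path_elt K (@trivial_path D4_quiver v)).
Definition arrow_elt a : SA := pr (path_elt K (@arrow_path D4_quiver a)).

Lemma vertex_elt_idem u v :
  vertex_elt u * vertex_elt v = if vertex_eqb u v then vertex_elt u else 0.
Proof.
rewrite /vertex_elt -prM [_ * _]path_mulE path_comp1p /= vertex_eqbE /path_source /=.
by case: eqP => [->|] //=; rewrite (lin_zero pr_linear).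
Qed.

Lemma vertex_arrow_elt a : vertex_elt (D4_source a) * arrow_elt a = arrow_elt a.
Proof. by rewrite /vertex_elt /arrow_elt -prM [_ * _]path_mulE path_comp1p eqxx. Qed.

Lemma arrow_vertex_elt a : arrow_elt a * vertex_elt (D4_target a) = arrow_elt a.
Proof. by rewrite /vertex_elt /arrow_elt -prM [_ * _]path_mulE path_compp1 eqxx. Qed.

Lemma arrow_elt_rel4 :
  arrow_elt beta * arrow_elt alpha + arrow_elt delta * arrow_elt gamma +
    arrow_elt epsilon * arrow_elt xi = 0.
Proof.
rewrite /arrow_elt -!prM -!prD; apply/pr_eq0/ideal_gen_base.
by constructor 1.
Qed.

Lemma arrow_elt_rel3 : arrow_elt gamma * arrow_elt delta = 0.
Proof. by rewrite /arrow_elt -prM; apply/pr_eq0/ideal_gen_base; constructor 2. Qed.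

Lemma arrow_elt_rel2 : arrow_elt xi * arrow_elt epsilon = 0.
Proof. by rewrite /arrow_elt -prM; apply/pr_eq0/ideal_gen_base; constructor 3. Qed.

Lemma arrow_elt_rel1 : arrow_elt alpha * arrow_elt beta = 0.
Proof. by rewrite /arrow_elt -prM; apply/pr_eq0/ideal_gen_base; constructor 4. Qed.

Definition standard_elt p : SA := value vertex_elt arrow_elt p.

Lemma standard_elt_mul_arrow p a : p \in normal_words ->
  standard_elt p * arrow_elt a = \sum_(q <- word_mul_arrow p a) standard_elt q.
Proof.
exact: (value_mul_arrow char2 vertex_elt_idem vertex_arrow_elt
  arrow_vertex_elt arrow_elt_rel4 arrow_elt_rel3 arrow_elt_rel2 arrow_elt_rel1).
Qed.

End Standard.

(** * A basis of the standard algebra *)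

Lemma uniq_normal : uniq normal_words.
Proof.
have uniqE s : uniq s = (fix uniqb (t : seq word) :=
    if t is p :: t' then ~~ word_mem p t' && uniqb t' else true) s.
  by elim: s => //= p s ->; rewrite word_memE.
by rewrite uniqE; vm_compute.
Qed.

(** The resolution depends on the algebra only through these data, which have
    forgotten the presentation as a quotient of the path algebra. *)
Record word_basis (K : fieldType) (A : algType K) := WordBasis {
  basis_elt :> word -> A;
  basis_coord : A -> {malg K[word]};
  basis_coord_linear : linear basis_coord;
  basis_coord_elt : forall p, p \in normal_words ->
    basis_coord (basis_elt p) = << p >>;
  basis_expand : forall x,
    x = \sum_(p <- normal_words) (basis_coord x)@_p *: basis_elt p;
  basis_elt_mul : forall p q, p \in normal_words -> q \in normal_words ->
    basis_elt p * basis_elt q = \sum_(r <- word_mul p q) basis_elt r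
}.

Section Coordinates.
Variable K : fieldType.
Hypothesis char2 : 2%N \in [pchar K].

Local Notation PA := (path_algebra K D4_quiver).
Local Notation SA := (standard_algebra K).
Local Notation pr := (@quot_proj K PA (D4_ideal K)).
Local Notation V := {malg K[word]}.

Definition words_mul_arrow (s : seq word) a :=
  flatten [seq word_mul_arrow p a | p <- s].

Definition word_sum (s : seq word) : V := \sum_(p <- s) << p >>.

(** Right multiplication by an arrow on the space spanned by words.  Words that are
    not normal are sent to zero, which makes the relations act as zero on the
    whole space. *)
Definition arrow_act a : V -> V := lin_ext (fun p => word_sum (word_mul_arrow p a)).
Definition vertex_act v : V -> V :=
  lin_ext (fun p => if vertex_eqb (word_target p) v then << p >> else 0).

Lemma arrow_act_word_sum a s :
  arrow_act a (word_sum s) = word_sum (words_mul_arrow s a).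
Proof.
rewrite /word_sum /arrow_act (lin_sum (lin_ext_linear _)).
rewrite /words_mul_arrow big_flatten big_map.
by apply: eq_bigr => p _; rewrite [LHS]lin_extU.
Qed.

Lemma vertex_act_word_sum v s :
  vertex_act v (word_sum s) = word_sum [seq p <- s | vertex_eqb (word_target p) v].
Proof.
rewrite /word_sum /vertex_act (lin_sum (lin_ext_linear _)) big_filter [RHS]big_mkcond.
by apply: eq_bigr => p _; rewrite lin_extU.
Qed.

Definition word_act (w : seq D4_arrow) (x : V) :=
  foldl (fun x a => arrow_act a x) x w.

Definition qpath_act (r : qpath D4_quiver) (x : V) : V :=
  word_act (path_arrows r) (vertex_act (path_source r) x).

Definition act (z : PA) (x : V) : V := lin_ext (fun r => qpath_act r x) z.

Lemma word_act_linear w : linear (word_act w).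
Proof.
elim: w => [|a w IHw] //=.
exact: (lin_comp IHw (lin_ext_linear _)).
Qed.

Lemma qpath_act_linear r : linear (qpath_act r).
Proof. exact: lin_comp (word_act_linear _) (lin_ext_linear _). Qed.

Lemma act_linear z : linear (act z).
Proof.
move=> c x y; rewrite /act /lin_ext scaler_sumr -big_split; apply: eq_bigr => r _.
by rewrite qpath_act_linear scalerDr !scalerA mulrC.
Qed.

Lemma act_linearl x : linear (act^~ x).
Proof. exact: lin_ext_linear. Qed.

Lemma actE r x : act (path_elt K r) x = qpath_act r x.
Proof. by rewrite /act unlock lin_extU. Qed.

Lemma word_mul_arrow_spec p a :
  all (fun q => word_mem q normal_words && vertex_eqb (word_target q) (D4_target a))
    (word_mul_arrow p a).
Proof.
case np: (p \in normal_words); last by rewrite /word_mul_arrow word_memE np.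
have : all (fun p => all (fun a => all (fun q => word_mem q normal_words &&
    vertex_eqb (word_target q) (D4_target a)) (word_mul_arrow p a)) arrows)
  normal_words by vm_compute.
by move=> /allP/(_ _ np)/allP/(_ _ (mem_arrows a)).
Qed.

Lemma vertex_act_idem u v x :
  vertex_act u (vertex_act v x) = if vertex_eqb u v then vertex_act v x else 0.
Proof.
move: x; apply: malg_ext.
- exact: lin_comp (lin_ext_linear _) (lin_ext_linear _).
- by case: vertex_eqb; [exact: lin_ext_linear | move=> ? ? ?; rewrite scaler0 addr0].
move=> p; rewrite /vertex_act lin_extU.
case pv: (vertex_eqb (word_target p) v); last first.
  by rewrite (lin_zero (lin_ext_linear _)) if_same.
by rewrite lin_extU; case: (word_target p) pv => //; case: v => //; case: u.
Qed.

Lemma vertex_act_arrow v a x :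
  vertex_act v (arrow_act a x) =
    if vertex_eqb v (D4_target a) then arrow_act a x else 0.
Proof.
move: x; apply: malg_ext.
- exact: lin_comp (lin_ext_linear _) (lin_ext_linear _).
- by case: vertex_eqb; [exact: lin_ext_linear | move=> ? ? ?; rewrite scaler0 addr0].
move=> p; rewrite /arrow_act lin_extU /word_sum /vertex_act.
rewrite (lin_sum (lin_ext_linear _)).
rewrite big_seq [X in if _ then X else _]big_seq.
transitivity (\sum_(q <- word_mul_arrow p a | q \in word_mul_arrow p a)
  if vertex_eqb v (D4_target a) then << q >> else 0 : V); last first.
  by case: ifP => // _; rewrite big1.
apply: eq_bigr => q /(allP (word_mul_arrow_spec p a))/andP[_].
rewrite vertex_eqbE => /eqP tq.
by rewrite [LHS]lin_extU tq !vertex_eqbE eq_sym.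
Qed.

Lemma vertex_act_word w u y :
  (forall v, vertex_act v y = if v == u then y else 0) ->
  forall v, vertex_act v (word_act w y) =
    if v == @walk_end D4_quiver u w then word_act w y else 0.
Proof.
elim: w u y => //= a w IHw u y _ v; apply: IHw => {}v.
by rewrite vertex_act_arrow vertex_eqbE.
Qed.

Lemma vertex_act_qpath v (r : qpath D4_quiver) x :
  vertex_act v (qpath_act r x) = if v == path_target r then qpath_act r x else 0.
Proof.
apply: vertex_act_word => u; rewrite vertex_act_idem vertex_eqbE.
by [].
Qed.

Lemma actM x y m : act (x * y) m = act y (act x m).
Proof.
have L1 z : linear (fun x => act (x * z) m).
  apply: (lin_comp (act_linearl m)); exact: regular_linearl.
have L2 z : linear (fun y => act (z * y) m).
  apply: (lin_comp (act_linearl m)); exact: regular_linearr.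
move: x; apply: malg_ext => [||r]; first exact: L1.
  exact: lin_comp (act_linear y) (act_linearl m).
move: y; apply: malg_ext => [||s]; [exact: L2 | exact: act_linearl |].
have -> : << r >> = path_elt K r by rewrite unlock.
have -> : << s >> = path_elt K s by rewrite unlock.
rewrite [_ * _]path_mulE !actE.
case: (eqVneq (path_source s) (path_target r)) => [e|ne].
  have [t -> vt] := path_comp_val e; rewrite /= actE.
  rewrite [in RHS]/qpath_act vertex_act_qpath e eqxx.
  by rewrite /qpath_act /path_source /path_arrows vt /= /word_act foldl_cat.
rewrite path_comp_None //= (lin_zero (act_linearl m)).
rewrite [in RHS]/qpath_act vertex_act_qpath (negbTE ne).
by rewrite (lin_zero (word_act_linear _)).
Qed.

Lemma act_arrow a x : act (path_elt K (@arrow_path D4_quiver a)) x = arrow_act a x.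
Proof.
rewrite actE /qpath_act /path_source /path_arrows /=; move: x; apply: malg_ext.
- exact: lin_comp (lin_ext_linear _) (lin_ext_linear _).
- exact: lin_ext_linear.
move=> p; rewrite /vertex_act lin_extU.
case ne: (vertex_eqb (word_target p) (D4_source a)); first by [].
rewrite /arrow_act (lin_zero (lin_ext_linear _)) lin_extU /word_mul_arrow ne if_same.
by rewrite /word_sum big_nil.
Qed.

(** This is the independence of the normal words.  Only the four relations need an
    argument: on each normal word they give a list in which everything cancels in
    pairs, and they kill the other words by definition. *)
Lemma act_ideal z x : ideal_gen (@D4_relation K) z -> act z x = 0.
Proof.
move=> Iz; elim: Iz x => {z} [z Rz||y z _ y0 _ z0|y z _ z0|y z _ z0] x.
- have word_sumU p : << p >> = word_sum [:: p] by rewrite /word_sum big_seq1.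
  have word_sum_cat s t : word_sum (s ++ t) = word_sum s + word_sum t.
    by rewrite /word_sum big_cat.
  have normal0 (s : word -> seq word) :
      (forall p, p \notin normal_words -> s p = [::]) ->
      all (fun p => even_multiplicity word_eqb (s p)) normal_words ->
      forall p, word_sum (s p) = 0.
    move=> s0 /allP s_even p; case: (boolP (p \in normal_words)) => [/s_even|/s0 ->].
      exact: (even_multiplicity_sum word_eqbE).
    by rewrite /word_sum big_nil.
  have mul_arrow0 p a : p \notin normal_words -> words_mul_arrow [:: p] a = [::].
    by move=> np; rewrite /words_mul_arrow /= /word_mul_arrow word_memE (negbTE np).
  case: Rz => ->; move: x; apply: malg_ext; try exact: act_linear;
    try (by move=> ? ? ?; rewrite scaler0 addr0);
    move=> p; rewrite ?(lin_add (act_linearl _)) !actM !act_arrow word_sumU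
      !arrow_act_word_sum -?word_sum_cat.
  + apply: (normal0 (fun p => (words_mul_arrow (words_mul_arrow [:: p] beta) alpha ++
      words_mul_arrow (words_mul_arrow [:: p] delta) gamma) ++
      words_mul_arrow (words_mul_arrow [:: p] epsilon) xi)); last by vm_compute.
    by move=> q nq; rewrite !mul_arrow0.
  + apply: (normal0 (fun p =>
      words_mul_arrow (words_mul_arrow [:: p] gamma) delta)); last by vm_compute.
    by move=> q nq; rewrite !mul_arrow0.
  + apply: (normal0 (fun p =>
      words_mul_arrow (words_mul_arrow [:: p] xi) epsilon)); last by vm_compute.
    by move=> q nq; rewrite !mul_arrow0.
  + apply: (normal0 (fun p =>
      words_mul_arrow (words_mul_arrow [:: p] alpha) beta)); last by vm_compute.
    by move=> q nq; rewrite !mul_arrow0.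
- exact: lin_zero (act_linearl x).
- by rewrite (lin_add (act_linearl x)) y0 z0 addr0.
- by rewrite actM z0.
- by rewrite actM z0 (lin_zero (act_linear y)).
Qed.

(** The image of the unit, which is the sum of the trivial words, under the action
    of a representative in the path algebra. *)
Definition standard_coord (x : SA) : V :=
  act (repr x) (word_sum (map vertex_word vertices)).

Lemma standard_coord_pr z :
  standard_coord (pr z) = act z (word_sum (map vertex_word vertices)).
Proof.
apply/eqP; rewrite -subr_eq0 -(lin_sub (act_linearl _)).
have /quot_projE Iz : pr (repr (pr z)) = pr z by exact: quot_projK.
by rewrite (act_ideal _ Iz).
Qed.

Lemma standard_coord_linear : linear standard_coord.
Proof.
move=> c; elim/quot_ind=> x; elim/quot_ind=> y.
by rewrite -prZ -prD !standard_coord_pr act_linearl.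
Qed.

Lemma standard_coordM x z : standard_coord (x * pr z) = act z (standard_coord x).
Proof. by elim/quot_ind: x => x; rewrite -prM !standard_coord_pr actM. Qed.

Lemma standard_coord_elt p : p \in normal_words ->
  standard_coord (standard_elt K p) = << p >>.
Proof.
have E v w : standard_coord (standard_elt K (v, w)) =
    word_sum (foldl words_mul_arrow [:: vertex_word v] w).
  elim/last_ind: w => [|w a IHw]; last first.
    rewrite /standard_elt value_rcons standard_coordM.
    rewrite -/(standard_elt K (v, w)) IHw act_arrow foldl_rcons.
    exact: arrow_act_word_sum.
  rewrite /standard_elt /value big_nil mulr1 /vertex_elt standard_coord_pr actE.
  rewrite /qpath_act /path_source /path_arrows /= vertex_act_word_sum.
  by case: v.
move=> np; case: p np => v w np; rewrite E.
have /allP/(_ _ np) : all (fun p =>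
    even_multiplicity word_eqb
      (foldl words_mul_arrow [:: vertex_word p.1] p.2 ++ [:: p])) normal_words.
  by vm_compute.
move/(even_multiplicity_eq word_eqbE (fun p => << p >> : V) char2).
by rewrite big_seq1.
Qed.

Lemma pr_path_elt (r : qpath D4_quiver) : pr (path_elt K r) = standard_elt K (val r).
Proof.
have [v [w vr]] : exists v w, val r = (v, w).
  by exists (val r).1, (val r).2; case: (val r).
rewrite vr; elim: w v r vr => [|a w IHw] v r vr.
  rewrite /standard_elt /value big_nil mulr1; congr (pr (path_elt K _)).
  exact: val_inj.
have := valP r; rewrite vr => /andP[/eqP /= va wk].
pose s : qpath D4_quiver := exist _ (D4_target a, w) wk.
have [t E vt] := @path_comp_val D4_quiver (arrow_path a) s erefl.
have tr : t = r by apply: val_inj; rewrite vt vr -va.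
have <- : path_elt K (@arrow_path D4_quiver a) * path_elt K s = path_elt K r.
  by rewrite [LHS]path_mulE E tr.
rewrite prM -/(arrow_elt K a) (IHw _ s erefl) /standard_elt /value /= big_cons.
rewrite [LHS]mulrA [RHS]mulrA -va; congr (_ * _).
by rewrite [LHS]arrow_vertex_elt [RHS]vertex_arrow_elt.
Qed.

Definition of_coord : V -> SA :=
  lin_ext (fun p => if word_mem p normal_words then standard_elt K p else 0).

Lemma of_coordU p :
  of_coord << p >> = if p \in normal_words then standard_elt K p else 0.
Proof. by rewrite /of_coord lin_extU word_memE. Qed.

Lemma of_coord_word_sum s : all (word_mem^~ normal_words) s ->
  of_coord (word_sum s) = \sum_(p <- s) standard_elt K p.
Proof.
move=> /allP ns; rewrite /of_coord /word_sum (lin_sum (lin_ext_linear _)).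
rewrite !big_seq; apply: eq_bigr => p /ns np.
by rewrite [LHS]lin_extU np.
Qed.

(** Rewriting is compatible with multiplication in the algebra.  Applied to the
    unit it shows that the normal words span ([standard_coordK]). *)
Lemma of_coord_act z x : of_coord (act z x) = of_coord x * pr z.
Proof.
have fL : linear of_coord by exact: lin_ext_linear.
have arrowE a y : of_coord (arrow_act a y) = of_coord y * arrow_elt K a.
  move: y; apply: malg_ext => [||p].
  - exact: lin_comp fL (lin_ext_linear _).
  - exact: lin_comp (regular_linearl _) fL.
  rewrite /arrow_act lin_extU of_coord_word_sum; last first.
    by apply: sub_all (word_mul_arrow_spec p a) => q /andP[].
  rewrite of_coordU; case np: (p \in normal_words).
    by rewrite standard_elt_mul_arrow.
  by rewrite mul0r /word_mul_arrow word_memE np big_nil.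
have vertE v y : of_coord (vertex_act v y) = of_coord y * vertex_elt K v.
  move: y; apply: malg_ext => [||p].
  - exact: lin_comp fL (lin_ext_linear _).
  - exact: lin_comp (regular_linearl _) fL.
  rewrite /vertex_act lin_extU of_coordU; case np: (p \in normal_words); last first.
    rewrite mul0r; case: (vertex_eqb _ _); rewrite ?(lin_zero fL) //.
    by rewrite of_coordU np.
  rewrite /standard_elt -(value_tgt (@vertex_elt_idem K) (@arrow_vertex_elt K)).
  rewrite -mulrA vertex_elt_idem.
  case: (vertex_eqb _ _); last by rewrite mulr0 (lin_zero fL).
  by rewrite of_coordU np (value_tgt (@vertex_elt_idem K) (@arrow_vertex_elt K)).
move: z; apply: malg_ext => [||r].
- exact: lin_comp fL (act_linearl _).
- exact: lin_comp (regular_linearr _) (@pr_linear K).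
have -> : << r >> = path_elt K r by rewrite unlock.
rewrite actE /qpath_act pr_path_elt /standard_elt /value mulrA -vertE.
move: (vertex_act _ _) => y; rewrite -/(path_arrows r).
elim: (path_arrows r) y => [|a w IHw] y; first by rewrite big_nil mulr1.
by rewrite /= IHw arrowE big_cons mulrA.
Qed.

Lemma standard_coordK : cancel standard_coord of_coord.
Proof.
elim/quot_ind=> z; rewrite standard_coord_pr of_coord_act of_coord_word_sum //.
rewrite -[RHS]mul1r; congr (_ * _).
rewrite -[1]/(pr (path_one K D4_quiver)) (lin_sum (@pr_linear K)) big_map.
have uniq_vertices : uniq vertices by rewrite /= !inE -!vertex_eqbE.
rewrite [LHS](big_uniq _ uniq_vertices) /=.
apply: eq_big => [v|v _]; first by rewrite mem_vertices.
by rewrite /standard_elt /value big_nil mulr1.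
Qed.

Lemma standard_coord_expand x :
  x = \sum_(p <- normal_words) (standard_coord x)@_p *: standard_elt K p.
Proof.
have L : linear (fun y : V => \sum_(p <- normal_words) y@_p *: standard_elt K p).
  move=> c y z; rewrite scaler_sumr -big_split; apply: eq_bigr => p _.
  by rewrite mcoeffD mcoeffZ scalerDl scalerA.
rewrite -{1}[x]standard_coordK; move: (standard_coord x); apply: malg_ext => [||p].
- exact: lin_ext_linear.
- exact: L.
rewrite of_coordU; case: (boolP (p \in normal_words)) => np; last first.
  rewrite big_seq big1 // => q nq; rewrite mcoeffU.
  by case: eqP => [e|_]; [rewrite e nq in np | rewrite scale0r].
rewrite (bigD1_seq p) ?uniq_normal //= big1 => [|q ne].
  by rewrite mcoeffUU scale1r addr0.
by rewrite mcoeffU eq_sym (negbTE ne) scale0r.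
Qed.

Lemma standard_elt_mul p q : p \in normal_words ->
  standard_elt K p * standard_elt K q = \sum_(r <- word_mul p q) standard_elt K r.
Proof.
move=> np; have tgtE r := value_tgt (@vertex_elt_idem K) (@arrow_vertex_elt K) r.
rewrite /word_mul; case tp: (vertex_eqb (word_target p) q.1); last first.
  rewrite big_nil /standard_elt -(tgtE p) /value -!mulrA.
  rewrite (mulrA (vertex_elt _ _) (vertex_elt _ _)).
  by rewrite vertex_elt_idem tp mul0r !mulr0.
have -> : standard_elt K p * standard_elt K q =
    standard_elt K p * \prod_(a <- q.2) arrow_elt K a.
  rewrite {2}/standard_elt /value mulrA; move: tp; rewrite vertex_eqbE => /eqP <-.
  by rewrite [standard_elt K p * _]tgtE.
have: all (word_mem^~ normal_words) [:: p] by rewrite all_seq1 word_memE np.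
rewrite -[standard_elt K p](big_seq1 +%R p (standard_elt K)).
elim: (q.2) [:: p] => [|a w IHw] s ns; first by rewrite big_nil mulr1.
rewrite big_cons mulrA mulr_suml /=.
have -> : \sum_(i <- s) standard_elt K i * arrow_elt K a =
    \sum_(i <- flatten [seq word_mul_arrow x a | x <- s]) standard_elt K i.
  rewrite big_flatten big_map !big_seq; apply: eq_bigr => x /(allP ns).
  by rewrite word_memE => /(standard_elt_mul_arrow char2) ->.
apply: IHw; apply/allP => x /flatten_mapP[y _ xy].
by have /andP[] := allP (word_mul_arrow_spec y a) _ xy.
Qed.

Definition standard_basis : word_basis SA :=
  WordBasis standard_coord_linear standard_coord_elt standard_coord_expand
    (fun p q np _ => standard_elt_mul q np).

End Coordinates.

(** * The projective bimodules generated by labels *)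

Definition triple := (word * word * word)%type.
Implicit Types t : triple.

(** A triple [(p, g, q)] stands for [p (x) g (x) q], that is, for [p (x) q] in the
    summand [A e_i (x) e_j A] of the label [g : i -> j]. *)
Definition composable (G : seq word) (t : triple) : bool :=
  let: (p, g, q) := t in
  [&& word_mem p normal_words, word_mem g G, word_mem q normal_words,
      vertex_eqb (word_target p) g.1 & vertex_eqb (word_target g) q.1].

Lemma composable_normal G t : composable G t ->
  [/\ t.1.1 \in normal_words, word_mem t.1.2 G & t.2 \in normal_words].
Proof. by case: t => -[p g] q /and5P[]; rewrite !(word_memE _ normal_words). Qed.

Definition triple_eqb (s t : triple) : bool :=
  let: (p, g, q) := s in let: (p', g', q') := t in
  if word_eqb p p' then if word_eqb g g' then word_eqb q q' else false else false.

Lemma triple_eqbE : triple_eqb =2 eq_op.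
Proof.
move=> [[p g] q] [[p' g'] q']; rewrite /triple_eqb !word_eqbE.
by case: eqP => [->|ne]; [case: eqP => [->|ne]; [case: eqP => [->|ne]|]|];
   apply/esym; [exact: eqxx | by apply/eqP => -[] ..].
Qed.

Section WordBasis.
Variables (K : fieldType) (A : algType K) (bs : word_basis A).
Local Notation elt := (basis_elt bs).
Local Notation coord := (basis_coord bs).

Lemma elt_ext (W : lmodType K) (f g : A -> W) : linear f -> linear g ->
  (forall p, p \in normal_words -> f (elt p) = g (elt p)) -> f =1 g.
Proof.
move=> fL gL fg x; rewrite (basis_expand bs x) (lin_sum fL) (lin_sum gL).
rewrite !big_seq; apply: eq_bigr => p np.
by rewrite (lin_scale fL) (lin_scale gL) fg.
Qed.

Lemma vertex_word_normal v : vertex_word v \in normal_words.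
Proof. by rewrite -word_memE; case: v. Qed.

Lemma elt_vertex_r p v : p \in normal_words ->
  elt p * elt (vertex_word v) = if vertex_eqb (word_target p) v then elt p else 0.
Proof.
move=> np; rewrite (basis_elt_mul bs np (vertex_word_normal v)) /word_mul.
rewrite [(vertex_word v).1]/= [(vertex_word v).2]/=.
by case: (vertex_eqb _ _); rewrite ?big_nil // [foldl _ _ _]/= big_seq1.
Qed.

Lemma elt_vertex_l v p : 2%N \in [pchar K] -> p \in normal_words ->
  elt (vertex_word v) * elt p = if vertex_eqb v p.1 then elt p else 0.
Proof.
move=> char2 np; rewrite (basis_elt_mul bs (vertex_word_normal v) np).
case vp: (vertex_eqb v p.1); last by rewrite /word_mul [word_target _]/= vp big_nil.
have -> : v = p.1 by apply/eqP; rewrite -vertex_eqbE.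
rewrite -[RHS](big_seq1 +%R p elt).
apply: (even_multiplicity_eq word_eqbE _ char2); move: p np {vp}; apply/allP.
by vm_compute.
Qed.

Lemma vertex_eqb_refl v : vertex_eqb v v. Proof. by case: v. Qed.

End WordBasis.

Section FreeModule.
Variables (K : fieldType) (G : seq word).
Definition composable_triple := {t : triple | composable G t}.
Definition free_mod := {malg K[composable_triple]}.
HB.instance Definition _ := GRing.Lmodule.on free_mod.
End FreeModule.

(** Zero for a triple that is not composable, in accordance with [e_i e_k = 0] for
    distinct vertices.  Sums over all triples then need no side conditions. *)
HB.lock Definition pure (K : fieldType) (G : seq word) (t : triple) : free_mod K G :=
  if insub t is Some x then << (x : composable_triple G) >> else 0.

HB.lock Definition free_lin (K : fieldType) (G : seq word) (W : lmodType K)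
    (F : triple -> W) : free_mod K G -> W :=
  lin_ext (fun x : composable_triple G => F (val x)).

HB.lock Definition tensor (K : fieldType) (A : algType K) (bs : word_basis A)
    (G : seq word) (g : word) (x y : A) : free_mod K G :=
  lin_ext (fun p => lin_ext (fun q => pure K G (p, g, q)) (basis_coord bs y))
    (basis_coord bs x).

Section FreeModuleTheory.
Variables (K : fieldType) (G : seq word).
Local Notation free_mod := (free_mod K G).
Local Notation pure := (pure K G).

Lemma pure_val (x : composable_triple G) : << x >> = pure (val x) :> free_mod.
Proof. by rewrite unlock valK. Qed.

Lemma pure_out t : composable G t = false -> pure t = 0.
Proof. by rewrite unlock => tF; rewrite insubF. Qed.

Lemma free_ext (W : lmodType K) (f f' : free_mod -> W) : linear f -> linear f' ->
  (forall t, composable G t -> f (pure t) = f' (pure t)) -> f =1 f'.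
Proof.
by move=> fL fL' e; apply: malg_ext => // x; rewrite pure_val e ?(valP x).
Qed.

Lemma free_lin_linear (W : lmodType K) (F : triple -> W) : linear (@free_lin K G W F).
Proof. by rewrite unlock; exact: lin_ext_linear. Qed.

Lemma free_linE (W : lmodType K) (F : triple -> W) t :
  composable G t -> free_lin F (pure t) = F t.
Proof. by move=> okt; rewrite free_lin.unlock pure.unlock insubT lin_extU. Qed.

End FreeModuleTheory.

Section FreeBimodule.
Variables (K : fieldType) (A : algType K) (bs : word_basis A).
Local Notation elt := (basis_elt bs).
Local Notation coord := (basis_coord bs).

Hypothesis char2 : 2%N \in [pchar K].
Variable G : seq word.
Local Notation free_mod := (free_mod K G).
Local Notation pure := (pure K G).
Local Notation tensor := (tensor bs G).
Local Notation elt_ext := (@elt_ext _ _ bs).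
Local Notation elt_vertex_l := (fun v => @elt_vertex_l _ _ bs v _ char2).
Local Notation elt_vertex_r := (@elt_vertex_r _ _ bs).

Lemma tensor_linearl g y : linear (tensor g ^~ y).
Proof.
by rewrite unlock; exact: (lin_comp (lin_ext_linear _) (basis_coord_linear bs)).
Qed.

Lemma tensor_linearr g x : linear (tensor g x).
Proof.
have L p : linear (fun y => lin_ext (fun q => pure (p, g, q)) (coord y)).
  exact: lin_comp (lin_ext_linear _) (basis_coord_linear bs).
move=> c y z.
have E y' : tensor g x y' = \sum_(p <- msupp (coord x)) (coord x)@_p *:
  lin_ext (fun q => pure (p, g, q)) (coord y') by rewrite tensor.unlock.
rewrite !E scaler_sumr -big_split; apply: eq_bigr => p _.
by rewrite L scalerDr !scalerA mulrC.
Qed.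

Lemma tensor_elt g p q : p \in normal_words -> q \in normal_words ->
  tensor g (elt p) (elt q) = pure (p, g, q).
Proof. by move=> np nq; rewrite tensor.unlock !basis_coord_elt // !lin_extU. Qed.

Lemma tensor_vertex_l g x y : tensor g x y = tensor g (x * elt (vertex_word g.1)) y.
Proof.
move: x; apply: elt_ext => [||p np]; first exact: tensor_linearl.
  exact: lin_comp (tensor_linearl g y) (regular_linearl _).
move: y; apply: elt_ext => [||q nq]; try exact: tensor_linearr.
rewrite (elt_vertex_r _ np); case pg: (vertex_eqb (word_target p) g.1).
  by [].
rewrite (lin_zero (tensor_linearl g _)) (tensor_elt _ np nq) pure_out; first by [].
by rewrite /composable pg !andbF.
Qed.

Lemma tensor_vertex_r g x y :
  tensor g x y = tensor g x (elt (vertex_word (word_target g)) * y).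
Proof.
move: y; apply: elt_ext => [||q nq]; first exact: tensor_linearr.
  exact: lin_comp (tensor_linearr g x) (regular_linearr _).
move: x; apply: elt_ext => [||p np]; try exact: tensor_linearl.
rewrite (elt_vertex_l _ nq); case gq: (vertex_eqb (word_target g) q.1).
  by [].
rewrite (lin_zero (tensor_linearr g _)) (tensor_elt _ np nq) pure_out; first by [].
by rewrite /composable gq !andbF.
Qed.

Lemma tensor_out g x y : word_mem g G = false -> tensor g x y = 0.
Proof.
move=> nG; move: x; apply: (elt_ext) => [||p np].
- exact: tensor_linearl.
- by move=> ? ? ?; rewrite scaler0 addr0.
move: y; apply: (elt_ext) => [||q nq].
- exact: tensor_linearr.
- by move=> ? ? ?; rewrite scaler0 addr0.
by rewrite (tensor_elt _ np nq) pure_out // /composable nG andbF.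
Qed.

Lemma bilin_ext (W : lmodType K) (f f' : A -> A -> W) :
  (forall y, linear (f^~ y)) -> (forall x, linear (f x)) ->
  (forall y, linear (f'^~ y)) -> (forall x, linear (f' x)) ->
  (forall p q, p \in normal_words -> q \in normal_words ->
     f (elt p) (elt q) = f' (elt p) (elt q)) ->
  forall x y, f x y = f' x y.
Proof.
move=> fl fr fl' fr' e x y; move: x; apply: (elt_ext) => // p np.
by move: y; apply: (elt_ext) => // q nq; apply: e.
Qed.

(** A balanced bilinear map [f], one that does not see the parts of [x] outside
    [A e_i] and of [y] outside [e_j A], vanishes on the pairs of words that do not
    fit the label, so it agrees with its linear extension from composable triples
    on all tensors. *)
Lemma free_lin_tensor (W : lmodType K) (F : triple -> W) (f : A -> A -> W) g :
  (forall y, linear (f^~ y)) -> (forall x, linear (f x)) -> word_mem g G ->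
  (forall p q, composable G (p, g, q) -> F (p, g, q) = f (elt p) (elt q)) ->
  (forall x y, f x y =
     f (x * elt (vertex_word g.1)) (elt (vertex_word (word_target g)) * y)) ->
  forall x y, free_lin F (tensor g x y) = f x y.
Proof.
move=> fl fr Gg Ff f_vert; apply: bilin_ext => // [y|x|p q np nq].
- exact: lin_comp (free_lin_linear _) (tensor_linearl _ _).
- exact: lin_comp (free_lin_linear _) (tensor_linearr _ _).
rewrite (tensor_elt _ np nq); case ok_pq: (composable G (p, g, q)).
  by rewrite free_linE ?Ff.
rewrite (pure_out K ok_pq) (lin_zero (free_lin_linear _)) f_vert.
move: ok_pq; rewrite /composable Gg !word_memE np nq !andTb.
rewrite (elt_vertex_r _ np) (elt_vertex_l _ nq).
case: (vertex_eqb (word_target p) g.1) => [|_]; last by rewrite (lin_zero (fl _)).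
by rewrite andTb => ->; rewrite (lin_zero (fr _)).
Qed.

Definition free_lact (x : A) : free_mod -> free_mod :=
  free_lin (fun t => tensor t.1.2 (x * elt t.1.1) (elt t.2)).
Definition free_ract (m : free_mod) (y : A) : free_mod :=
  free_lin (fun t => tensor t.1.2 (elt t.1.1) (elt t.2 * y)) m.

Lemma free_lact_tensor g x y z : free_lact z (tensor g x y) = tensor g (z * x) y.
Proof.
case Gg: (word_mem g G); last first.
  by rewrite !(tensor_out _ _ Gg) /free_lact (lin_zero (free_lin_linear _)).
apply: (free_lin_tensor (f := fun x y => tensor g (z * x) y)) => [u|u||p q _|u w].
- exact: lin_comp (tensor_linearl _ _) (regular_linearr _).
- exact: tensor_linearr.
- exact: Gg.
- reflexivity.
- by rewrite -tensor_vertex_r [LHS]tensor_vertex_l mulrA.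
Qed.

Lemma free_ract_tensor g x y z : free_ract (tensor g x y) z = tensor g x (y * z).
Proof.
case Gg: (word_mem g G).
  rewrite /free_ract.
  apply: (free_lin_tensor (f := fun x y => tensor g x (y * z))) => [u|u||p q _|u w].
  - exact: tensor_linearl.
  - exact: lin_comp (tensor_linearr _ _) (regular_linearl _).
  - exact: Gg.
  - reflexivity.
  - by rewrite -tensor_vertex_l [LHS]tensor_vertex_r mulrA.
by rewrite !(tensor_out _ _ Gg) /free_ract (lin_zero (free_lin_linear _)).
Qed.

Lemma pure_tensor t : composable G t -> pure t = tensor t.1.2 (elt t.1.1) (elt t.2).
Proof.
move=> okt; have [np _ nq] := composable_normal okt.
by case: t np nq {okt} => -[p g] q /= np nq; rewrite tensor_elt.
Qed.

Lemma free_lact_linear x : linear (free_lact x).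
Proof. exact: free_lin_linear. Qed.

Lemma free_ract_linear y : linear (free_ract^~ y).
Proof.
exact: (free_lin_linear (fun t => tensor t.1.2 (elt t.1.1) (elt t.2 * y))).
Qed.

Lemma free_lact_linearl m : linear (free_lact^~ m).
Proof.
move=> c x y; move: m; apply: free_ext => [||t okt].
- exact: free_lact_linear.
- exact: lin_comb (free_lact_linear _) (free_lact_linear _).
by rewrite (pure_tensor okt) !free_lact_tensor mulrDl -scalerAl tensor_linearl.
Qed.

Lemma free_ract_linearr m : linear (free_ract m).
Proof.
move=> c x y; move: m; apply: free_ext => [||t okt].
- exact: free_ract_linear.
- exact: lin_comb (free_ract_linear _) (free_ract_linear _).
by rewrite (pure_tensor okt) !free_ract_tensor mulrDr -scalerAr tensor_linearr.
Qed.

Definition free_bimodule : bimodule A.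
Proof.
refine (@Bimodule K A free_mod free_lact free_ract _ _
  free_lact_linearl free_lact_linear _ _ free_ract_linear free_ract_linearr _).
- apply: free_ext => [||t okt]; [exact: free_lact_linear | by [] |].
  by rewrite (pure_tensor okt) free_lact_tensor mul1r.
- move=> x y; apply: free_ext => [||t okt]; first exact: free_lact_linear.
    exact: lin_comp (free_lact_linear _) (free_lact_linear _).
  by rewrite (pure_tensor okt) !free_lact_tensor mulrA.
- apply: free_ext => [||t okt]; [exact: free_ract_linear | by [] |].
  by rewrite (pure_tensor okt) free_ract_tensor mulr1.
- move=> x y; apply: free_ext => [||t okt]; first exact: free_ract_linear.
    exact: lin_comp (free_ract_linear _) (free_ract_linear _).
  by rewrite (pure_tensor okt) !free_ract_tensor mulrA.
- move=> x y; apply: free_ext => [||t okt].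
  + exact: lin_comp (free_ract_linear _) (free_lact_linear _).
  + exact: lin_comp (free_lact_linear _) (free_ract_linear _).
  by rewrite (pure_tensor okt) !(free_ract_tensor, free_lact_tensor).
Defined.

Lemma lact_tensor g x y z :
  lact z (tensor g x y : free_bimodule) = tensor g (z * x) y.
Proof. exact: free_lact_tensor. Qed.

Lemma ract_tensor g x y z :
  ract (tensor g x y : free_bimodule) z = tensor g x (y * z).
Proof. exact: free_ract_tensor. Qed.

Definition gen g : free_bimodule :=
  tensor g (elt (vertex_word g.1)) (elt (vertex_word (word_target g))).

(** The elements [v g] lie in [e_i N e_j]; these are the families that extend to
    bimodule maps, so bimodule maps from [P(G)] to [N] correspond to elements of
    the product of the spaces [e_i N e_j]. *)
Definition fits (N : bimodule A) (v : word -> N) := forall g, word_mem g G ->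
  v g = lact (elt (vertex_word g.1)) (ract (v g) (elt (vertex_word (word_target g)))).

Definition free_hom (N : bimodule A) (v : word -> N) : free_bimodule -> N :=
  free_lin (fun t => lact (elt t.1.1) (ract (v t.1.2) (elt t.2))).

Section Universal.
Variables (N : bimodule A) (v : word -> N).
Hypothesis fits_v : fits v.

Lemma free_hom_tensor g x y : word_mem g G ->
  free_hom v (tensor g x y) = lact x (ract (v g) y).
Proof.
move=> Gg; apply: (free_lin_tensor (f := fun x y => lact x (ract (v g) y)))
  => [z|z||p q _|z w].
- exact: lact_linearl.
- exact: lin_comp (lact_linearr z) (ract_linearr _).
- exact: Gg.
- reflexivity.
- by rewrite lactM ractM -(lract (elt _)) -(fits_v Gg).
Qed.

Lemma free_hom_gen g : word_mem g G -> free_hom v (gen g) = v g.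
Proof. by move=> Gg; rewrite /gen free_hom_tensor // -fits_v. Qed.

Lemma free_hom_hom : bimodule_hom (free_hom v).
Proof.
have fL : linear (free_hom v) by exact: free_lin_linear.
split=> [|x m|x m]; first exact: fL.
- move: m; apply: free_ext => [||t okt].
  + exact: lin_comp fL (free_lact_linear _).
  + exact: lin_comp (lact_linearr _) fL.
  have [_ Gt _] := composable_normal okt.
  by rewrite (pure_tensor okt) lact_tensor !free_hom_tensor // lactM.
- move: m; apply: free_ext => [||t okt].
  + exact: lin_comp fL (free_ract_linear _).
  + exact: lin_comp (ract_linearl _) fL.
  have [_ Gt _] := composable_normal okt.
  by rewrite (pure_tensor okt) ract_tensor !free_hom_tensor // lract ractM.
Qed.

End Universal.

Lemma gen_act t : composable G t ->
  pure t = lact (elt t.1.1) (ract (gen t.1.2) (elt t.2)).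
Proof.
case: t => -[p g] q okt; have /and5P[] := okt; rewrite !word_memE => np _ nq.
rewrite !vertex_eqbE => /eqP pg /eqP gq.
rewrite /gen ract_tensor lact_tensor (elt_vertex_l _ nq) (elt_vertex_r _ np).
by rewrite pg gq !vertex_eqb_refl (pure_tensor okt).
Qed.

Lemma free_hom_uniq (N : bimodule A) (f : free_bimodule -> N) : bimodule_hom f ->
  f =1 free_hom (fun g => f (gen g)).
Proof.
move=> [fL fl fr]; apply: free_ext => [||t okt]; first exact: fL.
  exact: free_lin_linear.
by rewrite /free_hom (free_linE _ okt) {1}(gen_act okt) fl fr.
Qed.

Lemma elt_vertex_idem v :
  elt (vertex_word v) * elt (vertex_word v) = elt (vertex_word v).
Proof. by rewrite (elt_vertex_r _ (vertex_word_normal v)) vertex_eqb_refl. Qed.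

Lemma truncate_fits (N : bimodule A) (v : word -> N) :
  fits (fun g =>
    lact (elt (vertex_word g.1)) (ract (v g) (elt (vertex_word (word_target g))))).
Proof.
move=> g _; rewrite lract -lactM elt_vertex_idem.
by rewrite -ractM elt_vertex_idem.
Qed.

Lemma gen_fits (N : bimodule A) (f : free_bimodule -> N) : bimodule_hom f ->
  fits (fun g => f (gen g)).
Proof.
move=> [fL fl fr] g Gg; rewrite -fr -fl /gen ract_tensor lact_tensor.
by rewrite !elt_vertex_idem.
Qed.

(** Lift the images of the generators arbitrarily and multiply the lifts by the
    idempotents of their labels on both sides. *)
Lemma free_projective : projective free_bimodule.
Proof.
move=> M N g f hg g_surj hf; have [gL gl gr] := hg.
pose m w := sval (cid (g_surj (f (gen w)))).
have gm w : g (m w) = f (gen w) by exact: (svalP (cid (g_surj (f (gen w))))).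
pose v w :=
  lact (elt (vertex_word w.1)) (ract (m w) (elt (vertex_word (word_target w)))).
have fits_v : fits v by exact: truncate_fits.
have hh := free_hom_hom fits_v; exists (free_hom v) => // x.
rewrite (free_hom_uniq (hom_comp hg hh)) (free_hom_uniq hf).
move: x; apply: free_ext => [||t okt]; try exact: free_lin_linear.
rewrite [LHS](free_linE _ okt) [RHS](free_linE _ okt); congr (lact _ (ract _ _)).
have [_ Gt _] := composable_normal okt.
rewrite (free_hom_gen fits_v Gt) /v gl gr gm.
by rewrite -(gen_fits hf Gt).
Qed.

End FreeBimodule.

(** * Differentials and contracting homotopy on words *)

Definition vertex_labels := map vertex_word vertices.
Definition arrow_labels := map arrow_word arrows.

Definition flat_map (T U : Type) (F : T -> seq U) (s : seq T) : seq U :=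
  flatten [seq F x | x <- s].

(** The bimodule map that sends the generator [g] to the sum of [D g], as a map on
    triples. *)
Definition sandwich (D : word -> seq triple) t : seq triple :=
  flat_map (fun u => [seq (x, u.1.2, y) | x <- word_mul t.1.1 u.1.1,
                                          y <- word_mul u.2 t.2]) (D t.1.2).

Definition diff1_gen g : seq triple :=
  [:: (g, vertex_word (word_target g), vertex_word (word_target g));
      (vertex_word g.1, vertex_word g.1, g)].

Definition relation_at v : seq (D4_arrow * D4_arrow) :=
  match v with
  | V1 => [:: (alpha, beta)]
  | V2 => [:: (xi, epsilon)]
  | V3 => [:: (gamma, delta)]
  | V4 => [:: (beta, alpha); (delta, gamma); (epsilon, xi)]
  end.

(** Each of the two arrows of a term of the relation becomes the label of a summand,
    with the other arrow as its outer factor. *)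
Definition diff2_gen g : seq triple :=
  flat_map (fun ab => [:: (vertex_word g.1, arrow_word ab.1, arrow_word ab.2);
                          (arrow_word ab.1, arrow_word ab.2, vertex_word g.1)])
    (relation_at g.1).

(** The normal words of length 4, one for each vertex [i]; each of them starts and
    ends at [i] and spans the socle of [e_i A]. *)
Definition socle v : word :=
  match v with
  | V1 => (V1, [:: alpha; delta; gamma; beta])
  | V2 => (V2, [:: xi; beta; alpha; epsilon])
  | V3 => (V3, [:: gamma; beta; alpha; delta])
  | V4 => (V4, [:: beta; alpha; delta; gamma])
  end.

(** The pairs of dual basis words for the symmetrizing form: [q] is the normal word
    for which [p q] involves the socle word at the source of [p]. *)
Definition diff3_gen g : seq triple :=
  [seq (p, vertex_word (word_target p), q) |
    p <- [seq p <- normal_words | vertex_eqb p.1 g.1],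
    q <- [seq q <- normal_words |
           if vertex_eqb (word_target q) g.1
           then has (word_eqb (socle g.1)) (word_mul p q) else false]].

Definition diff1 := sandwich diff1_gen.
Definition diff2 := sandwich diff2_gen.
Definition diff3 := sandwich diff3_gen.

Fixpoint cuts (p : word) (w : seq D4_arrow) : seq triple :=
  if w is a :: w' then
    (p, arrow_word a, (D4_target a, w')) ::
      flat_map (fun x => cuts x w') (word_mul_arrow p a)
  else [::].

(** The left linear map that cuts the right factor at each of its arrows inverts
    [d1] up to the augmentation, as the terms of [d1 h0] telescope.  Its values
    are composable triples since a suffix of a normal word is normal. *)
Definition homotopy0 t : seq triple := cuts t.1.1 t.2.2.

(** The entry for [(a, w)] lists the triples of an element [z] with
    [d2 z = e (x) a (x) w + h0 (d1 (e (x) a (x) w))].  Since [h0] has been chosen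
    with [d1 h0 = 1] on the image of [d1], the right-hand side is a cycle and such a
    [z] exists.  It is unique up to the image of [d3], and the choice is fixed by the
    condition that no right factor is a socle word, which makes [h2 h1 = 0].  The
    table is the solution of these linear equations. *)
Definition homotopy1_gen (a : D4_arrow) (w : seq D4_arrow) :
    seq (seq D4_arrow * D4_vertex * seq D4_arrow) :=
  match a, w with
  | alpha, [:: beta] =>
      [:: ([::], V1, [::])]
  | alpha, [:: beta; alpha] =>
      [:: ([::], V1, [:: alpha])]
  | alpha, [:: beta; alpha; delta] =>
      [:: ([::], V1, [:: alpha; delta])]
  | alpha, [:: beta; alpha; epsilon] =>
      [:: ([::], V1, [:: alpha; epsilon])]
  | alpha, [:: beta; alpha; delta; gamma] =>
      [:: ([::], V1, [:: alpha; delta; gamma])]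
  | beta, [:: alpha; delta; gamma; beta] =>
      [:: ([::], V4, [:: delta; gamma; beta]);
          ([:: epsilon], V2, [:: xi; beta]);
          ([:: delta], V3, [:: gamma; beta]);
          ([:: beta; alpha], V4, [:: beta]);
          ([:: delta; gamma], V4, [:: beta]);
          ([:: delta; gamma; beta], V1, [::])]
  | xi, [:: epsilon] =>
      [:: ([::], V2, [::])]
  | xi, [:: delta; gamma] =>
      [:: ([::], V2, [:: xi]); ([:: xi], V4, [::])]
  | xi, [:: delta; gamma; beta] =>
      [:: ([::], V2, [:: xi; beta]); ([:: xi], V4, [:: beta]);
          ([:: xi; beta], V1, [::])]
  | xi, [:: beta; alpha; delta] =>
      [:: ([::], V2, [:: xi; delta]); ([:: xi], V4, [:: delta]);
          ([:: xi; delta], V3, [::])]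
  | xi, [:: beta; alpha; delta; gamma] =>
      [:: ([::], V2, [:: xi; beta; alpha]); ([:: xi], V4, [:: delta; gamma]);
          ([:: xi; delta], V3, [:: gamma])]
  | epsilon, [:: xi] =>
      [:: ([::], V4, [::])]
  | epsilon, [:: xi; beta] =>
      [:: ([::], V4, [:: beta]); ([:: beta], V1, [::])]
  | epsilon, [:: xi; delta] =>
      [:: ([::], V4, [:: delta]); ([:: delta], V3, [::])]
  | epsilon, [:: xi; beta; alpha] =>
      [:: ([::], V4, [:: delta; gamma]); ([:: epsilon], V2, [:: xi]);
          ([:: delta], V3, [:: gamma]); ([:: beta; alpha], V4, [::]);
          ([:: delta; gamma], V4, [::])]
  | epsilon, [:: xi; beta; alpha; epsilon] =>
      [:: ([::], V4, [:: beta; alpha; epsilon]);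
          ([:: beta], V1, [:: alpha; epsilon]);
          ([:: delta], V3, [:: gamma; epsilon]);
          ([:: delta; gamma], V4, [:: epsilon]);
          ([:: beta; alpha; epsilon], V2, [::])]
  | gamma, [:: delta] =>
      [:: ([::], V3, [::])]
  | gamma, [:: delta; gamma] =>
      [:: ([::], V3, [:: gamma])]
  | gamma, [:: delta; gamma; beta] =>
      [:: ([::], V3, [:: gamma; beta])]
  | gamma, [:: beta; alpha; epsilon] =>
      [:: ([::], V3, [:: gamma; epsilon]); ([:: gamma], V4, [:: epsilon]);
          ([:: gamma; epsilon], V2, [::])]
  | gamma, [:: beta; alpha; delta; gamma] =>
      [:: ([::], V3, [:: gamma; beta; alpha]);
          ([:: gamma], V4, [:: beta; alpha]);
          ([:: gamma], V4, [:: delta; gamma]);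
          ([:: gamma; beta], V1, [:: alpha]);
          ([:: gamma; epsilon], V2, [:: xi]);
          ([:: gamma; beta; alpha], V4, [::])]
  | delta, [:: gamma; epsilon] =>
      [:: ([::], V4, [:: epsilon]); ([:: epsilon], V2, [::])]
  | delta, [:: gamma; beta; alpha] =>
      [:: ([::], V4, [:: beta; alpha]); ([::], V4, [:: delta; gamma]);
          ([:: beta], V1, [:: alpha]); ([:: epsilon], V2, [:: xi]);
          ([:: delta], V3, [:: gamma]); ([:: beta; alpha], V4, [::]);
          ([:: delta; gamma], V4, [::])]
  | delta, [:: gamma; beta; alpha; delta] =>
      [:: ([::], V4, [:: beta; alpha; delta]);
          ([:: beta], V1, [:: alpha; delta]);
          ([:: epsilon], V2, [:: xi; delta]);
          ([:: beta; alpha], V4, [:: delta]);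
          ([:: delta; gamma], V4, [:: delta]);
          ([:: beta; alpha; delta], V3, [::])]
  | _, _ => [::]
  end.

Definition homotopy1 t : seq triple :=
  flat_map (fun a =>
    flat_map (fun u => [seq (x, vertex_word u.1.2, (u.1.2, u.2)) |
                         x <- word_mul t.1.1 (D4_source a, u.1.1)])
      (homotopy1_gen a t.2.2)) t.1.2.2.

(** Reading off the coefficient of the socle word in the right factor inverts the
    embedding of [A] into [P(vertices)]: among the dual pairs [p (x) p'] only
    [e_i (x) s_i] contributes.  The result [p] in [A] is then lifted to
    [P(vertices)] as [p (x) e]. *)
Definition homotopy2 t : seq triple :=
  if word_eqb t.2 (socle t.1.2.1)
  then [:: (t.1.1, vertex_word (word_target t.1.1), vertex_word (word_target t.1.1))]
  else [::].

Definition all_triples (G : seq word) (P : triple -> bool) : bool :=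
  all (fun g => all (fun p => all (fun q => P (p, g, q))
    [seq q <- normal_words | vertex_eqb (word_target g) q.1])
    [seq p <- normal_words | vertex_eqb (word_target p) g.1]) G.

Lemma all_triplesP G P : all_triples G P -> forall t, composable G t -> P t.
Proof.
move=> /allP allG t; case: t => -[p g] q okt; have /and5P[] := okt.
rewrite !word_memE => np Gg nq pg gq.
have /allP/(_ p) := allG _ Gg; rewrite mem_filter pg np => /(_ isT).
by move=> /allP/(_ q); rewrite mem_filter gq nq => /(_ isT).
Qed.

Definition respects G G' (F : triple -> seq triple) :=
  all_triples G (fun t => all (composable G') (F t)).

(** The parity form of [1 = d h + h' d']. *)
Definition is_contraction G (F F' E E' : triple -> seq triple) :=
  all_triples G (fun t =>
    even_multiplicity triple_eqb (t :: flat_map F (E t) ++ flat_map E' (F' t))).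

Definition is_zero G (F F' : triple -> seq triple) :=
  all_triples G (fun t => even_multiplicity triple_eqb (flat_map F' (F t))).

Lemma diff1_respects : respects arrow_labels vertex_labels diff1.
Proof. by vm_compute. Qed.
Lemma diff2_respects : respects vertex_labels arrow_labels diff2.
Proof. by vm_compute. Qed.
Lemma diff3_respects : respects vertex_labels vertex_labels diff3.
Proof. by vm_compute. Qed.
Lemma homotopy0_respects : respects vertex_labels arrow_labels homotopy0.
Proof. by vm_compute. Qed.
Lemma homotopy1_respects : respects arrow_labels vertex_labels homotopy1.
Proof. by vm_compute. Qed.
Lemma homotopy2_respects : respects vertex_labels vertex_labels homotopy2.
Proof. by vm_compute. Qed.

Lemma diff1_diff2 : is_zero vertex_labels diff2 diff1.
Proof. by vm_compute. Qed.
Lemma diff2_diff3 : is_zero vertex_labels diff3 diff2.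
Proof. by vm_compute. Qed.
Lemma diff3_diff1 : is_zero arrow_labels diff1 diff3.
Proof. by vm_compute. Qed.

Lemma contraction1 : is_contraction arrow_labels diff2 diff1 homotopy1 homotopy0.
Proof. by vm_compute. Qed.
Lemma contraction2 : is_contraction vertex_labels diff3 diff2 homotopy2 homotopy1.
Proof. by vm_compute. Qed.
Lemma contraction3 : is_contraction vertex_labels diff1 diff3 homotopy0 homotopy2.
Proof. by vm_compute. Qed.

(** * The periodic resolution *)

Lemma word_mul_normal p q : p \in normal_words -> q \in normal_words ->
  all (fun r => r \in normal_words) (word_mul p q).
Proof.
move=> np nq; have /allP/(_ _ np)/allP/(_ _ nq) :
    all (fun p => all (fun q => all (word_mem^~ normal_words) (word_mul p q))
      normal_words) normal_words.
  by vm_compute.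
by apply: sub_all => r; rewrite word_memE.
Qed.

Section ListMaps.
Variables (K : fieldType).
Hypothesis char2 : 2%N \in [pchar K].

Definition triple_sum G (s : seq triple) : free_mod K G := \sum_(t <- s) pure K G t.

Definition list_map G G' (F : triple -> seq triple) :
    free_mod K G -> free_mod K G' :=
  free_lin (fun t => triple_sum G' (F t)).

Lemma list_map_linear G G' F : linear (@list_map G G' F).
Proof. exact: free_lin_linear. Qed.

Lemma list_map_triple_sum G G' F (s : seq triple) : all (composable G) s ->
  list_map G' F (triple_sum G s) = triple_sum G' (flat_map F s).
Proof.
move=> /allP oks; rewrite /triple_sum /flat_map big_flatten big_map.
rewrite (lin_sum (@list_map_linear G G' F)) !big_seq; apply: eq_bigr => t /oks okt.
exact: free_linE.
Qed.

Lemma list_map_pure G G' F t : composable G t ->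
  list_map G' F (pure K G t) = triple_sum G' (F t).
Proof. exact: free_linE. Qed.

Lemma list_map_zero G G' G'' F F' : respects G G' F -> is_zero G F F' ->
  forall x, list_map G'' F' (@list_map G G' F x) = 0.
Proof.
move=> oks z; apply: free_ext => [||t okt].
- exact: lin_comp (@list_map_linear G' G'' F') (@list_map_linear G G' F).
- by move=> ? ? ?; rewrite scaler0 addr0.
rewrite (list_map_pure _ _ okt) (list_map_triple_sum _ _ (all_triplesP oks okt)).
exact: (even_multiplicity_sum triple_eqbE _ char2 (all_triplesP z okt)).
Qed.

Lemma list_map_contraction G1 G2 G3 F F' E E' :
  respects G2 G1 E -> respects G2 G3 F' -> is_contraction G2 F F' E E' ->
  forall x, x = list_map G2 F (@list_map G2 G1 E x) +
                list_map G2 E' (@list_map G2 G3 F' x).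
Proof.
move=> okE okF' z; apply: free_ext => [|| t okt].
- by [].
- have L1 := lin_comp (@list_map_linear G1 G2 F) (@list_map_linear G2 G1 E).
  have L2 := lin_comp (@list_map_linear G3 G2 E') (@list_map_linear G2 G3 F').
  move=> c x y; have := lin_comb 1 L1 L2 c x y.
  by rewrite !scale1r.
rewrite !(list_map_pure _ _ okt).
rewrite (list_map_triple_sum _ _ (all_triplesP okE okt)).
rewrite (list_map_triple_sum _ _ (all_triplesP okF' okt)).
rewrite /triple_sum -big_cat -[LHS](big_seq1 +%R t (pure K G2)).
exact: (even_multiplicity_eq (s := [:: t]) triple_eqbE _ char2
  (all_triplesP z okt)).
Qed.

End ListMaps.

Section Resolution.
Variables (K : fieldType) (A : algType K) (bs : word_basis A).
Hypothesis char2 : 2%N \in [pchar K].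
Local Notation elt := (basis_elt bs).
Local Notation free := (free_bimodule bs char2).
Local Notation Areg := (regular_bimodule A).

Definition diff_typed G G' (D : word -> seq triple) := all (fun g =>
  all (fun u => [&& composable G' u, vertex_eqb g.1 u.1.1.1 &
                    vertex_eqb (word_target u.2) (word_target g)]) (D g)) G.

Definition diff_hom G G' (D : word -> seq triple) : free G -> free G' :=
  free_hom (fun g => triple_sum K G' (D g) : free G').

Lemma tensor_sum G g (s s' : seq word) :
  all (fun r => r \in normal_words) s -> all (fun r => r \in normal_words) s' ->
  tensor bs G g (\sum_(p <- s) elt p) (\sum_(q <- s') elt q) =
  triple_sum K G [seq (p, g, q) | p <- s, q <- s'].
Proof.
move=> /allP ns /allP ns'; rewrite /triple_sum big_allpairs_dep.
rewrite (lin_sum (tensor_linearl bs G g _)).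
rewrite [LHS]big_seq [RHS]big_seq; apply: eq_bigr => p /ns np.
rewrite (lin_sum (tensor_linearr bs G g _)) !big_seq; apply: eq_bigr => q /ns' nq.
exact: tensor_elt.
Qed.

Section DiffHom.
Variables (G G' : seq word) (D : word -> seq triple).
Hypothesis D_typed : diff_typed G G' D.

Lemma diff_fits : fits bs G (fun g => triple_sum K G' (D g) : free G').
Proof.
move=> g; rewrite word_memE => Gg; have /allP D_g := allP D_typed _ Gg.
rewrite /triple_sum (lin_sum (ract_linearl _)) (lin_sum (lact_linearr _)) !big_seq.
apply: eq_bigr => u /D_g/and3P[oku gu ug]; rewrite (pure_tensor bs oku).
have [np _ nq] := composable_normal oku.
rewrite ract_tensor lact_tensor (elt_vertex_l bs _ char2 np) gu.
by rewrite (elt_vertex_r bs _ nq) ug.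
Qed.

Lemma diff_hom_hom : bimodule_hom (@diff_hom G G' D).
Proof. exact: free_hom_hom diff_fits. Qed.

(** For evaluation the bimodule map determined by the images of generators is
    replaced by a map on lists of triples. *)
Lemma diff_homE : @diff_hom G G' D =1 @list_map K G G' (sandwich D).
Proof.
apply: free_ext => [||t okt]; try exact: free_lin_linear.
rewrite (list_map_pure _ _ _ okt) [LHS](free_linE _ okt).
have [np Gt nq] := composable_normal okt; rewrite word_memE in Gt.
have /allP D_g := allP D_typed _ Gt.
rewrite /triple_sum (lin_sum (ract_linearl _)) (lin_sum (lact_linearr _)).
rewrite /sandwich /flat_map big_flatten big_map !big_seq.
apply: eq_bigr => u /D_g/and3P[oku _ _]; rewrite (pure_tensor bs oku).
have [np' _ nq'] := composable_normal oku.
rewrite ract_tensor lact_tensor !basis_elt_mul //.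
by rewrite tensor_sum ?word_mul_normal.
Qed.

End DiffHom.

Definition aug : free vertex_labels -> Areg := free_hom (fun g => elt g : Areg).

(** The map [x |-> x (x) e] is linear for the left action only; it starts the
    contracting homotopy. *)
Definition aug_section : A -> free vertex_labels := fun x =>
  lin_ext (fun p => pure K vertex_labels
    (p, vertex_word (word_target p), vertex_word (word_target p))) (basis_coord bs x).

Lemma aug_section_linear : linear aug_section.
Proof. exact: lin_comp (lin_ext_linear _) (basis_coord_linear bs). Qed.

Lemma aug_section_elt p : p \in normal_words ->
  aug_section (elt p) = pure K vertex_labels
    (p, vertex_word (word_target p), vertex_word (word_target p)).
Proof. by move=> np; rewrite /aug_section basis_coord_elt // lin_extU. Qed.

Lemma aug_hom : bimodule_hom aug.
Proof.
apply: free_hom_hom => g; rewrite word_memE => /mapP[v _ ->].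
by rewrite /= !(elt_vertex_idem bs).
Qed.

Lemma vertex_composable t : composable vertex_labels t ->
  [/\ t.1.1 \in normal_words, t.2 \in normal_words & elt t.1.2 * elt t.2 = elt t.2].
Proof.
case: t => -[p g] q /and5P[]; rewrite !word_memE => np /mapP[v _ ->] nq _ vq.
by split=> //; rewrite (elt_vertex_l bs _ char2 nq) vq.
Qed.

Lemma aug_pure t : composable vertex_labels t ->
  aug (pure K vertex_labels t) = \sum_(r <- word_mul t.1.1 t.2) (elt r : Areg).
Proof.
move=> okt; have [np nq e] := vertex_composable okt.
by rewrite [LHS](free_linE _ okt) /= e basis_elt_mul.
Qed.

Lemma aug_diff1 x : aug (@list_map K arrow_labels _ diff1 x) = 0.
Proof.
have augL := hom_linear aug_hom.
move: x; apply: free_ext => [||t okt].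
- exact: lin_comp augL (@list_map_linear _ _ _ _).
- by move=> ? ? ?; rewrite scaler0 addr0.
rewrite (list_map_pure _ _ _ okt) /triple_sum (lin_sum augL).
have /allP diff1_ok := all_triplesP diff1_respects okt.
transitivity
    (\sum_(r <- flat_map (fun u => word_mul u.1.1 u.2) (diff1 t)) (elt r : Areg)).
  rewrite [in RHS]/flat_map [RHS]big_flatten [RHS]big_map [LHS]big_seq [RHS]big_seq.
  by apply: eq_bigr => u /diff1_ok; exact: aug_pure.
apply: (even_multiplicity_sum word_eqbE _ char2); move: t okt {diff1_ok}.
by apply: all_triplesP; vm_compute.
Qed.

Lemma aug_of_section x : aug (aug_section x) = x.
Proof.
move: x; apply: (elt_ext (bs := bs)) => [||p np].
- exact: lin_comp (hom_linear aug_hom) aug_section_linear.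
- by [].
rewrite (aug_section_elt np) aug_pure; last first.
  rewrite /composable !word_memE np vertex_word_normal mem_map ?mem_vertices //=.
    by rewrite !vertex_eqb_refl.
  by move=> u v [].
rewrite -[RHS](big_seq1 +%R p elt).
apply: (even_multiplicity_eq word_eqbE _ char2); move: p np; apply/allP.
by vm_compute.
Qed.

Lemma contraction0 x :
  x = list_map vertex_labels diff1 (list_map arrow_labels homotopy0 x) +
      aug_section (aug x).
Proof.
have L1 : linear (fun x => list_map vertex_labels diff1
    (@list_map K vertex_labels arrow_labels homotopy0 x)).
  exact: lin_comp (@list_map_linear _ _ _ _) (@list_map_linear _ _ _ _).
have L2 := lin_comp aug_section_linear (hom_linear aug_hom).
move: x; apply: free_ext => [||t okt]; first by [].
  by move=> c x y; have := lin_comb 1 L1 L2 c x y; rewrite !scale1r.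
rewrite (list_map_pure _ _ _ okt).
rewrite (list_map_triple_sum _ _ _ (all_triplesP homotopy0_respects okt)).
rewrite (aug_pure okt) (lin_sum aug_section_linear).
have [np nq _] := vertex_composable okt; have /allP nr := word_mul_normal np nq.
have -> : \sum_(r <- word_mul t.1.1 t.2) aug_section (elt r) =
    triple_sum K vertex_labels
      [seq (r, vertex_word (word_target r), vertex_word (word_target r)) |
        r <- word_mul t.1.1 t.2].
  rewrite /triple_sum big_map !big_seq.
  by apply: eq_bigr => r /nr; exact: aug_section_elt.
rewrite /triple_sum -big_cat -[LHS](big_seq1 +%R t (pure K vertex_labels)).
apply: (even_multiplicity_eq (s := [:: t]) triple_eqbE _ char2).
move: t okt {np nq nr}; by apply: all_triplesP; vm_compute.
Qed.

Definition d1 : free arrow_labels -> free vertex_labels := diff_hom _ diff1_gen.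
Definition d2 : free vertex_labels -> free arrow_labels := diff_hom _ diff2_gen.
Definition d3 : free vertex_labels -> free vertex_labels := diff_hom _ diff3_gen.

Lemma diff1_typed : diff_typed arrow_labels vertex_labels diff1_gen.
Proof. by vm_compute. Qed.
Lemma diff2_typed : diff_typed vertex_labels arrow_labels diff2_gen.
Proof. by vm_compute. Qed.
Lemma diff3_typed : diff_typed vertex_labels vertex_labels diff3_gen.
Proof. by vm_compute. Qed.

Lemma d1E : d1 =1 list_map vertex_labels diff1.
Proof. exact: diff_homE diff1_typed. Qed.
Lemma d2E : d2 =1 list_map arrow_labels diff2.
Proof. exact: diff_homE diff2_typed. Qed.
Lemma d3E : d3 =1 list_map vertex_labels diff3.
Proof. exact: diff_homE diff3_typed. Qed.

Lemma d1_exact x : d1 x = 0 <-> exists y, x = d2 y.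
Proof.
split=> [|[y ->]]; rewrite d1E.
  move=> d0; exists (list_map vertex_labels homotopy1 x); rewrite d2E.
  rewrite {1}[x](list_map_contraction char2 homotopy1_respects diff1_respects
    contraction1).
  by rewrite d0 (lin_zero (@list_map_linear _ _ _ _)) addr0.
rewrite d2E.
exact: (list_map_zero char2 _ diff2_respects diff1_diff2).
Qed.

Lemma d2_exact x : d2 x = 0 <-> exists y, x = d3 y.
Proof.
split=> [|[y ->]]; rewrite d2E.
  move=> d0; exists (list_map vertex_labels homotopy2 x); rewrite d3E.
  rewrite {1}[x](list_map_contraction char2 homotopy2_respects diff2_respects
    contraction2).
  by rewrite d0 (lin_zero (@list_map_linear _ _ _ _)) addr0.
rewrite d3E.
exact: (list_map_zero char2 _ diff3_respects diff2_diff3).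
Qed.

Lemma d3_exact x : d3 x = 0 <-> exists y, x = d1 y.
Proof.
split=> [|[y ->]]; rewrite d3E.
  move=> d0; exists (list_map arrow_labels homotopy0 x); rewrite d1E.
  rewrite {1}[x](list_map_contraction char2 homotopy0_respects diff3_respects
    contraction3).
  by rewrite d0 (lin_zero (@list_map_linear _ _ _ _)) addr0.
rewrite d1E.
exact: (list_map_zero char2 _ diff1_respects diff3_diff1).
Qed.

Lemma aug_exact x : aug x = 0 <-> exists y, x = d1 y.
Proof.
split=> [aug0|[y ->]]; last by rewrite d1E aug_diff1.
exists (list_map arrow_labels homotopy0 x); rewrite d1E.
by rewrite {1}[x]contraction0 aug0 (lin_zero aug_section_linear) addr0.
Qed.

Lemma three_step_ind (P : nat -> Prop) :
  P 0 -> P 1 -> P 2 -> (forall n, P n -> P n.+3) -> forall n, P n.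
Proof.
move=> P0 P1 P2 P3 n; suff [] : [/\ P n, P n.+1 & P n.+2] by [].
by elim: n => [|n [Pn Pn1 Pn2]]; split=> //; apply: P3.
Qed.

(** Period 3 is possible because the kernel of the second differential is [A]
    again: the map from degree 3 to degree 2 is the augmentation followed by the
    embedding of this kernel. *)
Fixpoint periodic_obj (n : nat) : bimodule A :=
  match n with
  | 0 => free vertex_labels
  | 1 => free arrow_labels
  | 2 => free vertex_labels
  | n'.+3 => periodic_obj n'
  end.

Fixpoint periodic_diff (n : nat) : periodic_obj n.+1 -> periodic_obj n :=
  match n return periodic_obj n.+1 -> periodic_obj n with
  | 0 => d1
  | 1 => d2
  | 2 => d3
  | n'.+3 => @periodic_diff n'
  end.

Lemma periodic_projective n : projective (periodic_obj n).
Proof. by elim/three_step_ind: n => //=; apply: free_projective. Qed.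

Lemma periodic_diff_hom n : bimodule_hom (@periodic_diff n).
Proof.
elim/three_step_ind: n => [|||n IHn]; last exact: IHn.
- exact: diff_hom_hom diff1_typed.
- exact: diff_hom_hom diff2_typed.
- exact: diff_hom_hom diff3_typed.
Qed.

Lemma periodic_exact n (x : periodic_obj n.+1) :
  periodic_diff x = 0 <-> exists y, x = periodic_diff (n := n.+1) y.
Proof.
elim/three_step_ind: n x => [|||n IHn]; last exact: IHn.
- exact: d1_exact.
- exact: d2_exact.
- exact: d3_exact.
Qed.

Definition periodic_resolution : projective_resolution Areg :=
  ProjectiveResolution periodic_projective periodic_diff_hom aug_hom
    periodic_exact aug_exact
    (fun x => ex_intro _ (aug_section x) (aug_of_section x)).

End Resolution.

(** * Cocycles and coboundaries in degree 2 *)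

Definition word_mul3 p r q : seq word := flat_map (word_mul p) (word_mul r q).

(** The functional [x |-> coefficient of s in p x q] is the sum of the coordinate
    functionals at these words. *)
Definition middle_factors p q s : seq word :=
  [seq r <- normal_words | odd (count (word_eqb s) (word_mul3 p r q))].

(** For [x = (g, s)] and a cochain [f], the coefficient of [s] in [f (d g)] is the sum
    of the coefficients of [f] at these pairs of a label and a word. *)
Definition pulled_coefs (D : word -> seq triple) (x : word * word) :
    seq (word * word) :=
  flat_map (fun u => [seq (u.1.2, r) | r <- middle_factors u.1.1 u.2 x.2]) (D x.1).

Definition pair_eqb (x y : word * word) : bool :=
  word_eqb x.1 y.1 && word_eqb x.2 y.2.

Lemma pair_eqbE : pair_eqb =2 eq_op.
Proof. by move=> [x y] [x' y']; rewrite /pair_eqb !word_eqbE xpair_eqE. Qed.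

(** The coefficient of [e_1], the coefficient of [e_4], and the sum of the socle
    coefficients at the four vertices. *)
Definition invariant_pairs (i : nat) : seq (word * word) :=
  match i with
  | 0 => [:: (vertex_word V1, vertex_word V1)]
  | 1 => [:: (vertex_word V4, vertex_word V4)]
  | _ => [seq (g, socle g.1) | g <- vertex_labels]
  end.

(** The cochains with values [e_1 + e_2 + e_3], [e_4] and [s_4]. *)
Definition class_words (i : nat) g : seq word :=
  match i, g.1 with
  | 0, V4 => [::]
  | 0, _ => [:: g]
  | 1, V4 => [:: g]
  | 2, V4 => [:: socle V4]
  | _, _ => [::]
  end.

Definition elementary (x : word * word) g : seq word :=
  if word_eqb g x.1 then [:: x.2] else [::].

(** A 1-cochain with a single nonzero value, followed by the coefficient of a
    2-cocycle that its coboundary removes.  The first two bound [beta alpha] and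
    [delta gamma], the others bound [s_i + s_4] for [i = 1, 2, 3]. *)
Definition bounding_cochains : seq ((word * word) * (word * word)) :=
  [:: ((arrow_word alpha, arrow_word alpha),
       (vertex_word V4, (V4, [:: beta; alpha])));
      ((arrow_word gamma, arrow_word gamma),
       (vertex_word V4, (V4, [:: delta; gamma])));
      ((arrow_word alpha, (V1, [:: alpha; delta; gamma])),
       (vertex_word V1, socle V1));
      ((arrow_word xi, (V2, [:: xi; beta; alpha])),
       (vertex_word V2, socle V2));
      ((arrow_word gamma, (V3, [:: gamma; beta; alpha])),
       (vertex_word V3, socle V3))].

Definition pullback (D : word -> seq triple) (C : word -> seq word) g : seq word :=
  flat_map (fun u => flat_map (fun r => word_mul3 u.1.1 r u.2) (C u.1.2)) (D g).

Definition cochain_typed G (C : word -> seq word) := all (fun g =>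
  all (fun r => [&& word_mem r normal_words, vertex_eqb g.1 r.1 &
                    vertex_eqb (word_target r) (word_target g)]) (C g)) G.

Lemma class_typed i : cochain_typed vertex_labels (class_words i).
Proof. by case: i => [|[|[|i]]]. Qed.

Lemma bounding_cochains_typed :
  all (fun y => cochain_typed arrow_labels (elementary y.1)) bounding_cochains.
Proof. by vm_compute. Qed.

Lemma invariant_pairs_diff2 i : even_multiplicity pair_eqb
  (flat_map (pulled_coefs diff2_gen) (invariant_pairs i)).
Proof. by case: i => [|[|i]]; vm_compute. Qed.

Lemma class_invariants : all (fun i => all (fun j =>
  sumn [seq count (word_eqb x.2) (class_words j x.1) | x <- invariant_pairs i]
    == (i == j))%N
  [:: 0; 1; 2]%N) [:: 0; 1; 2]%N.
Proof. by vm_compute. Qed.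

Lemma class_words_closed i :
  all (fun g => even_multiplicity word_eqb (pullback diff3_gen (class_words i) g))
    vertex_labels.
Proof. by case: i => [|[|[|i]]]; vm_compute. Qed.

(** At the outer vertex 2 the cocycle condition reads [x_1 + x_3 = 0] for the
    coefficients [x_j] of [e_j]: the terms for [e_2] and [e_4] occur twice, as
    [e_2 A e_2] and [e_2 A e_4] have dimension 2. *)
Lemma cocycle_eq1 : even_multiplicity pair_eqb
  (pulled_coefs diff3_gen (vertex_word V2, socle V2) ++
   [:: (vertex_word V1, vertex_word V1); (vertex_word V3, vertex_word V3)]).
Proof. by vm_compute. Qed.

Lemma cocycle_eq2 : even_multiplicity pair_eqb
  (pulled_coefs diff3_gen (vertex_word V3, socle V3) ++
   [:: (vertex_word V1, vertex_word V1); (vertex_word V2, vertex_word V2)]).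
Proof. by vm_compute. Qed.

(** The coefficients that multiply the bounding cochains whose coboundary
    involves the word [p] at the vertex [g]. *)
Definition bounding g p : seq (word * word) :=
  [seq y.2 | y <- [seq y <- bounding_cochains |
     odd (count (word_eqb p) (pullback diff2_gen (elementary y.1) g))]].

(** Each coefficient [(g, p)] is matched by the correction on the nose, or, for the
    socle word at 4, up to the third invariant.  Otherwise the correction does not
    involve [p] at [g] and the coefficient vanishes, since [p] is trivial or is
    not a loop at [g]. *)
Lemma bounding_spec : all (fun g => all (fun p =>
  let s := (g, p) :: bounding g p in
  [|| even_multiplicity pair_eqb s,
      even_multiplicity pair_eqb (s ++ invariant_pairs 2) |
      if s is [:: _] then word_eqb p (vertex_word p.1) ||
        ~~ (vertex_eqb p.1 g.1 && vertex_eqb (word_target p) g.1)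
      else false])
  normal_words) vertex_labels.
Proof. by vm_compute. Qed.

Section Cohomology.
Variables (K : fieldType) (A : algType K) (bs : word_basis A).
Hypothesis char2 : 2%N \in [pchar K].
Local Notation elt := (basis_elt bs).
Local Notation coord := (basis_coord bs).
Local Notation free := (free_bimodule bs char2).
Local Notation Areg := (regular_bimodule A).
Local Notation P := (periodic_resolution bs char2).

Lemma basis_elt_mul3 p r q :
  p \in normal_words -> r \in normal_words -> q \in normal_words ->
  elt p * (elt r * elt q) = \sum_(s <- word_mul3 p r q) elt s.
Proof.
move=> np nr nq; rewrite basis_elt_mul // mulr_sumr /word_mul3 /flat_map.
rewrite big_flatten big_map.
rewrite [LHS]big_seq [RHS]big_seq; apply: eq_bigr => x xr.
by rewrite basis_elt_mul // (allP (word_mul_normal nr nq)).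
Qed.

Lemma word_mul3_normal p r q :
  p \in normal_words -> r \in normal_words -> q \in normal_words ->
  all (fun s => s \in normal_words) (word_mul3 p r q).
Proof.
move=> np nr nq; apply/allP => s /flatten_mapP[x xr].
by apply/allP/word_mul_normal => //; apply: (allP (word_mul_normal nr nq)).
Qed.

Definition coef (x : A) s : K^o := (coord x)@_s.

Lemma coef_linear s : linear (coef^~ s).
Proof. by move=> c x y; rewrite /coef basis_coord_linear mcoeffD mcoeffZ. Qed.

Lemma coef_sum_elt (l : seq word) s : all (fun r => r \in normal_words) l ->
  coef (\sum_(r <- l) elt r) s = (count (word_eqb s) l)%:R.
Proof.
move=> /allP nl; rewrite (lin_sum (coef_linear s)) -sum1_count natr_sum.
rewrite [RHS]big_mkcond.
rewrite [LHS]big_seq [RHS]big_seq; apply: eq_bigr => r /nl nr.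
by rewrite /coef basis_coord_elt // mcoeffU word_eqbE eq_sym; case: eqP.
Qed.

Lemma natr_odd n : n%:R = (odd n)%:R :> K.
Proof.
rewrite -{1}[n]odd_double_half natrD -mul2n natrM.
by rewrite (pcharf0 char2) mul0r addr0.
Qed.

Lemma coef_inj x y : (forall p, p \in normal_words -> coef x p = coef y p) -> x = y.
Proof.
move=> e; rewrite (basis_expand bs x) (basis_expand bs y) !big_seq.
by apply: eq_bigr => p /e; rewrite /coef => ->.
Qed.

(** Coefficients count the occurrences of a word in a list, and only the parity of a
    number matters in [K]. *)
Lemma coef_sandwich p q s x : p \in normal_words -> q \in normal_words ->
  coef (elt p * (x * elt q)) s = \sum_(r <- middle_factors p q s) coef x r.
Proof.
move=> np nq; move: x; apply: (elt_ext (bs := bs)) => [||r nr].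
- exact: (lin_comp (coef_linear s)
    (lin_comp (regular_linearr _) (regular_linearl _))).
- move=> c x y; rewrite scaler_sumr -big_split; apply: eq_bigr => r _.
  exact: coef_linear.
rewrite basis_elt_mul3 // coef_sum_elt ?word_mul3_normal // natr_odd.
rewrite /middle_factors big_filter big_mkcond (bigD1_seq r) ?uniq_normal //=.
rewrite big1 => [|r' ne].
  by rewrite /coef basis_coord_elt // mcoeffUU addr0; case: ifP.
by rewrite /coef basis_coord_elt // mcoeffU eq_sym (negbTE ne) if_same.
Qed.

Definition gen_coef G (f : free G -> A) (x : word * word) : K^o :=
  coef (f (gen bs char2 G x.1)) x.2.

Section Pullback.
Variables (G G' : seq word) (D : word -> seq triple).
Hypothesis D_typed : diff_typed G G' D.
Local Notation d := (@diff_hom K A bs char2 G G' D).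

Lemma hom_diff_gen (f : free G' -> Areg) g : bimodule_hom f -> word_mem g G ->
  f (d (gen bs char2 G g)) =
  \sum_(u <- D g) elt u.1.1 * (f (gen bs char2 G' u.1.2) * elt u.2) :> A.
Proof.
move=> [fL fl fr] Gg.
have -> : d (gen bs char2 G g) = triple_sum K G' (D g).
  exact: (free_hom_gen char2 (diff_fits bs char2 D_typed) Gg).
rewrite /triple_sum (lin_sum fL).
have /allP D_g : all (fun u => composable G' u) (D g).
  have := allP D_typed g; rewrite -word_memE => /(_ Gg).
  by apply: sub_all => u /and3P[].
rewrite [LHS]big_seq [RHS]big_seq; apply: eq_bigr => u /D_g oku.
by rewrite (gen_act bs char2 oku) fl fr.
Qed.

Lemma gen_coef_diff (f : free G' -> Areg) x : bimodule_hom f -> word_mem x.1 G ->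
  gen_coef (fun z => f (d z)) x = \sum_(y <- pulled_coefs D x) gen_coef f y.
Proof.
move=> hf Gx; rewrite /gen_coef (hom_diff_gen hf Gx) (lin_sum (coef_linear _)).
have /allP D_g : all (fun u => composable G' u) (D x.1).
  have := allP D_typed x.1; rewrite -word_memE => /(_ Gx).
  by apply: sub_all => u /and3P[].
rewrite /pulled_coefs [in RHS]/flat_map big_flatten big_map [LHS]big_seq [RHS]big_seq.
apply: eq_bigr => u /D_g oku; rewrite big_map.
have [np _ nq] := composable_normal oku.
exact: coef_sandwich.
Qed.

Lemma gen_hom_ext (N : bimodule A) (f f' : free G -> N) :
  bimodule_hom f -> bimodule_hom f' ->
  (forall g, word_mem g G -> f (gen bs char2 G g) = f' (gen bs char2 G g)) -> f =1 f'.
Proof.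
move=> hf hf' e x; rewrite (free_hom_uniq hf) (free_hom_uniq hf').
move: x; apply: free_ext => [||t okt]; try exact: free_lin_linear.
have [_ Gt _] := composable_normal okt.
by rewrite [LHS](free_linE _ okt) [RHS](free_linE _ okt) e.
Qed.

End Pullback.

Definition cochain G (C : word -> seq word) : free G -> Areg :=
  free_hom (fun g => \sum_(r <- C g) elt r : Areg).

Section Cochain.
Variables (G : seq word) (C : word -> seq word).
Hypothesis C_typed : cochain_typed G C.

Lemma cochain_fits : fits bs G (fun g => \sum_(r <- C g) elt r : Areg).
Proof.
move=> g; rewrite word_memE => Gg; have /allP C_g := allP C_typed _ Gg.
rewrite /= mulr_suml mulr_sumr !big_seq; apply: eq_bigr => r /C_g/and3P[].
rewrite word_memE => nr gr rg.
by rewrite (elt_vertex_r bs _ nr) rg (elt_vertex_l bs _ char2 nr) gr.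
Qed.

Lemma cochain_hom : bimodule_hom (@cochain G C).
Proof. exact: free_hom_hom cochain_fits. Qed.

Lemma cochain_gen g : word_mem g G ->
  cochain C (gen bs char2 G g) = \sum_(r <- C g) elt r :> A.
Proof. exact: (free_hom_gen char2 cochain_fits). Qed.

Lemma cochain_normal g : word_mem g G -> all (fun r => r \in normal_words) (C g).
Proof.
rewrite word_memE => Gg; have := allP C_typed _ Gg.
by apply: sub_all => r /and3P[]; rewrite word_memE.
Qed.

Lemma cochain_diff_gen G0 D g : diff_typed G0 G D -> word_mem g G0 ->
  cochain C (@diff_hom K A bs char2 G0 G D (gen bs char2 G0 g)) =
    \sum_(s <- pullback D C g) elt s :> A.
Proof.
move=> D_typed Gg; rewrite (hom_diff_gen D_typed cochain_hom Gg).
have /allP D_g : all (fun u => composable G u) (D g).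
  have := allP D_typed g; rewrite -word_memE => /(_ Gg).
  by apply: sub_all => u /and3P[].
rewrite /pullback [in RHS]/flat_map big_flatten big_map [LHS]big_seq [RHS]big_seq.
apply: eq_bigr => u /D_g oku.
have [np Gu nq] := composable_normal oku.
rewrite (cochain_gen Gu) mulr_suml mulr_sumr big_flatten big_map.
rewrite [LHS]big_seq [RHS]big_seq; apply: eq_bigr => r Cr.
by rewrite basis_elt_mul3 // (allP (cochain_normal Gu)).
Qed.

Lemma pullback_normal G0 D g : diff_typed G0 G D -> word_mem g G0 ->
  all (fun s => s \in normal_words) (pullback D C g).
Proof.
move=> D_typed Gg; have /allP D_g : all (fun u => composable G u) (D g).
  have := allP D_typed g; rewrite -word_memE => /(_ Gg).
  by apply: sub_all => u /and3P[].
apply/allP => s /flatten_mapP[u /D_g oku] /flatten_mapP[r Cr].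
have [np Gu nq] := composable_normal oku.
exact/allP/word_mul3_normal/nq/(allP (cochain_normal Gu) _ Cr).
Qed.

End Cochain.

Definition invariant i (f : free vertex_labels -> A) : K^o :=
  \sum_(x <- invariant_pairs i) gen_coef f x.

Lemma invariant_pairs_labels i x :
  x \in invariant_pairs i -> word_mem x.1 vertex_labels.
Proof.
have /allP H : all (fun x => word_mem x.1 vertex_labels) (invariant_pairs i).
  by case: i => [|[|i]]; vm_compute.
exact: H.
Qed.

Lemma invariant_coboundary i (f : P 2 -> Areg) :
  ext_coboundary f -> invariant i f = 0.
Proof.
move=> [h hh e]; rewrite /invariant.
transitivity
    (\sum_(y <- flat_map (pulled_coefs diff2_gen) (invariant_pairs i)) gen_coef h y).
  rewrite big_flatten big_map [LHS]big_seq [RHS]big_seq; apply: eq_bigr => x tx.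
  rewrite -(gen_coef_diff diff2_typed hh (invariant_pairs_labels tx)).
  by rewrite /gen_coef e.
exact: (even_multiplicity_sum pair_eqbE _ char2 (invariant_pairs_diff2 i)).
Qed.

Lemma invariant_class i j : (i < 3)%N -> (j < 3)%N ->
  invariant i (cochain (class_words j)) = (i == j)%:R.
Proof.
move=> i3 j3.
have /eqP <- : (sumn [seq count (word_eqb x.2) (class_words j x.1) |
                       x <- invariant_pairs i] == (i == j))%N.
  have mem3 k : (k < 3)%N -> k \in [:: 0; 1; 2]%N by case: k => [|[|[|k]]].
  by have /allP/(_ _ (mem3 _ i3))/allP/(_ _ (mem3 _ j3)) := class_invariants.
rewrite sumnE big_map natr_sum /invariant [LHS]big_seq [RHS]big_seq.
apply: eq_bigr => x /invariant_pairs_labels Gx.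
rewrite /gen_coef (cochain_gen (class_typed j) Gx) coef_sum_elt //.
exact: (cochain_normal (class_typed j) Gx).
Qed.

Lemma class_is_cocycle i : ext_cocycle (P := P) (n := 2) (cochain (class_words i)).
Proof.
have hc := cochain_hom (class_typed i); split; first exact: hc.
apply: gen_hom_ext => [||g Gg].
- exact: hom_comp hc (res_diff_hom P 2).
- exact: hom_zero.
rewrite [LHS](cochain_diff_gen (class_typed i) diff3_typed Gg).
apply: (even_multiplicity_sum word_eqbE _ char2).
by have /allP/(_ g) := class_words_closed i; rewrite -word_memE; apply.
Qed.

Lemma invariant_lin i (f : free vertex_labels -> A) I (s : seq I) (a : I -> K) c :
  invariant i (fun x => f x - \sum_(j <- s) a j *: c j x) =
  invariant i f - \sum_(j <- s) a j * invariant i (c j).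
Proof.
have -> : \sum_(j <- s) a j * invariant i (c j) =
    invariant i (fun x => \sum_(j <- s) a j *: c j x).
  rewrite /invariant; under eq_bigr do rewrite mulr_sumr.
  rewrite exchange_big /=; apply: eq_bigr => x _.
  rewrite /gen_coef (lin_sum (coef_linear _)); apply: eq_bigr => j _.
  by rewrite (lin_scale (coef_linear _)).
rewrite /invariant -sumrB; apply: eq_bigr => x _.
by rewrite /gen_coef (lin_sub (coef_linear _)).
Qed.

Lemma middle_factors_off u v p : p \in normal_words ->
  ~~ (vertex_eqb p.1 u && vertex_eqb (word_target p) v) ->
  middle_factors (vertex_word u) (vertex_word v) p = [::].
Proof.
move=> np /negbTE off.
have /allP/(_ _ (mem_vertices u))/allP/(_ _ (mem_vertices v))/allP/(_ _ np) :
    all (fun u => all (fun v => all (fun p =>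
      (vertex_eqb p.1 u && vertex_eqb (word_target p) v) ||
      nilp (middle_factors (vertex_word u) (vertex_word v) p))
      normal_words) vertices) vertices by vm_compute.
by rewrite off => /nilP.
Qed.

Lemma gen_coef_off G (f : free G -> Areg) g p : bimodule_hom f -> word_mem g G ->
  p \in normal_words ->
  ~~ (vertex_eqb p.1 g.1 && vertex_eqb (word_target p) (word_target g)) ->
  gen_coef f (g, p) = 0.
Proof.
move=> hf Gg np off; rewrite /gen_coef /= (gen_fits hf Gg) /=.
by rewrite coef_sandwich ?vertex_word_normal // middle_factors_off // big_nil.
Qed.

(** The first two invariants and the cocycle condition make the coefficients of all
    [e_i] vanish.  What is left is bounded by a combination of the bounding
    cochains, the coefficient of [s_4] being the sum of the other socle
    coefficients because of the third invariant. *)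
Lemma zero_invariants_coboundary (f : P 2 -> Areg) :
  ext_cocycle f -> (forall i, (i < 3)%N -> invariant i f = 0) -> ext_coboundary f.
Proof.
move=> [hf f0] inv0.
have gen_coef_rel s : (exists2 x, word_mem x.1 vertex_labels &
    even_multiplicity pair_eqb (pulled_coefs diff3_gen x ++ s)) ->
    \sum_(y <- s) gen_coef f y = 0.
  case=> x Gx /(even_multiplicity_eq pair_eqbE (gen_coef f : _ -> K^o) char2) <-.
  rewrite -(gen_coef_diff diff3_typed hf Gx) /gen_coef [f _]f0.
  exact: lin_zero (coef_linear _).
have gen_coef_vertex v : gen_coef f (vertex_word v, vertex_word v) = 0.
  have l1 := inv0 0%N isT; rewrite /invariant big_seq1 in l1.
  have l4 := inv0 1%N isT; rewrite /invariant big_seq1 in l4.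
  have l3 : gen_coef f (vertex_word V3, vertex_word V3) = 0.
    have := gen_coef_rel _
      (ex_intro2 _ _ (vertex_word V2, socle V2) isT cocycle_eq1).
    by rewrite big_cons big_seq1 l1 add0r.
  have l2 : gen_coef f (vertex_word V2, vertex_word V2) = 0.
    have := gen_coef_rel _
      (ex_intro2 _ _ (vertex_word V3, socle V3) isT cocycle_eq2).
    by rewrite big_cons big_seq1 l1 add0r.
  by case: v.
pose h (x : P 1) : Areg :=
  \sum_(y <- bounding_cochains)
    gen_coef f y.2 *: cochain (G := arrow_labels) (elementary y.1) x.
have hh : bimodule_hom h.
  apply: hom_comb => y by_; apply: cochain_hom; exact: (allP bounding_cochains_typed).
exists h => //; apply: gen_hom_ext => [||g Gg] //.
  exact: hom_comp hh (diff_hom_hom bs char2 diff2_typed).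
apply: coef_inj => p np.
transitivity (\sum_(y <- bounding g p) gen_coef f y); last first.
  rewrite /h (lin_sum (coef_linear _)) /bounding big_map big_filter [LHS]big_mkcond.
  rewrite [LHS]big_seq [RHS]big_seq; apply: eq_bigr => y by_.
  have wf := allP bounding_cochains_typed _ by_.
  rewrite (lin_scale (coef_linear _)) (cochain_diff_gen wf diff2_typed Gg).
  rewrite coef_sum_elt; last exact: (pullback_normal wf diff2_typed Gg).
  rewrite natr_odd; case: (odd _); first exact: esym (mulr1 _).
  exact: esym (mulr0 _).
rewrite -[coef _ _]/(gen_coef f (g, p)).
have off : ~~ (vertex_eqb p.1 g.1 && vertex_eqb (word_target p) g.1) ->
    gen_coef f (g, p) = 0.
  move=> off; apply: gen_coef_off => //.
  by move: Gg off; rewrite word_memE => /mapP[v _ ->].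
have parity s := even_multiplicity_eq (s := [:: (g, p)]) (t := s) pair_eqbE
  (gen_coef f : _ -> K^o) char2.
have /allP/(_ g) := bounding_spec; rewrite -word_memE => /(_ Gg)/allP/(_ _ np).
move=> /or3P[].
- by move/parity; rewrite big_seq1.
- move/parity.
  by rewrite big_seq1 big_cat /= [X in _ + X](inv0 2%N isT) addr0.
case: bounding => // /orP[|/off ->]; last by rewrite big_nil.
rewrite word_eqbE big_nil => /eqP ep.
case: (boolP (vertex_eqb p.1 g.1)) => [pg|ne]; last first.
  by apply: off; rewrite (negbTE ne).
have -> : g = p.
  move: Gg pg; rewrite word_memE vertex_eqbE => /mapP[v _ ->] /= /eqP <-.
  by rewrite -ep.
by rewrite ep gen_coef_vertex.
Qed.

(** The coordinates of a class are its invariants. *)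
Lemma HH2_periodic : cohomology_dim Areg P 2 3.
Proof.
exists (fun i : 'I_3 => cochain (class_words i)); split=> [i|f hf].
  exact: class_is_cocycle.
have invariant_sub i (a : 'rV[K]_3) : (i < 3)%N ->
    invariant i (fun x => f x - \sum_(j < 3) a 0 j *: cochain (class_words j) x)
    = invariant i f - \sum_(j < 3) a 0 j * (i == j)%:R.
  move=> i3; rewrite invariant_lin; congr (_ - _); apply: eq_bigr => j _.
  by rewrite invariant_class.
have coord_i (i : 'I_3) (a : 'rV[K]_3) :
    \sum_(j < 3) a 0 j * (i == j :> nat)%:R = a 0 i.
  rewrite (bigD1 i) //= eqxx mulr1 big1 ?addr0 // => j ne.
  by rewrite (inj_eq val_inj) eq_sym (negbTE ne) mulr0.
exists (\row_i invariant i f); split.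
  apply: zero_invariants_coboundary.
    have [hf0 f0] := hf; split=> [|x].
      by apply: hom_sub => //; apply: hom_comb => i _; have [] := class_is_cocycle i.
    rewrite f0 sub0r big1 ?oppr0 // => i _.
    by have [_ ->] := class_is_cocycle i; rewrite scaler0.
  move=> i i3; rewrite invariant_sub // (coord_i (Ordinal i3)) mxE.
  exact: subrr.
move=> b /invariant_coboundary inv_b; apply/rowP => i; rewrite mxE.
have := inv_b i; rewrite invariant_sub // coord_i => /eqP.
by rewrite subr_eq0 => /eqP.
Qed.

End Cohomology.

Theorem theorem4p1 (K : closedFieldType) (charK : 2%N \in [pchar K]) :
  HH_dim (standard_algebra K) 2 3.
Proof.
pose bs := standard_basis charK; split.
  by exists; exact: (periodic_resolution bs charK).
by move=> P; apply/cohomology_dim_indep/(HH2_periodic bs charK).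
Qed.
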